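(* Let $Q$ be an infinite $\mathbb{N}^*\setminus Q$--free set with $Q\subsetneq\mathbb{N}^*$, and let $n\ge 1$ be an integer and $\tau>1$ a real number. \begin{itemize} \item If $\nu(Q)<1$ and $\tau>1+1/n$, then $\dim W^*_{\tau,n}(Q)=(n+1)/\tau$. \item If $\nu(Q)=1$, $n\ge 2$ and $\tau>1+1/(n-1)$, then $n/\tau\le \dim W^*_{\tau,n}(Q)\le (n+1)/\tau$. \end{itemize}
   Context: $\mathbb{N}^*$ denotes the set of positive integers and $\dim$ denotes Hausdorff dimension. A set $Q\subseteq\mathbb{N}^*$ is called $\mathbb{N}^*\setminus Q$--free if for every $q\in\mathbb{N}^*$: $q\in Q$ if and only if no $v\in\mathbb{N}^*\setminus Q$ divides $q$. For an infinite set $Q\subseteq\mathbb{N}^*$, its exponent of convergence is $\nu(Q)=\inf\{\nu>0:\sum_{q\in Q}q^{-\nu}<\infty\}\in[0,1]$. For an integer $n\ge1$ and a real number $\tau>1$, $W_{\tau,n}$ is the set of $(x_1,\dots,x_n)\in\mathbb{R}^n$ for which there are infinitely many integers $q\ge1$ such that, for some integers $p_1,\dots,p_n$, $|x_i-p_i/q|<q^{-\tau}$ holds for all $i\in\{1,\dots,n\}$. For $Q\subseteq\mathbb{N}^*$, $W_{\tau,n}(Q)$ is defined in the same way, except that the infinitely many $q$ are required to lie in $Q$. Finally, $W^*_{\tau,n}(Q)=W_{\tau,n}\setminus W_{\tau,n}(Q)$. *)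

(* Defs.v *)
From Stdlib Require Import Reals Lra Lia ZArith Arith Classical ClassicalEpsilon.
Open Scope R_scope.

Definition Rn (n : nat) : Type := { x : nat -> R | forall i, (n <= i)%nat -> x i = 0 }.
Definition coord {n : nat} (x : Rn n) (i : nat) : R := proj1_sig x i.

Fixpoint sumsq (k : nat) (x y : nat -> R) : R :=
  match k with
  | O => 0
  | S k' => sumsq k' x y + (x k' - y k') ^ 2
  end.

Definition dist {n : nat} (x y : Rn n) : R := sqrt (sumsq n (proj1_sig x) (proj1_sig y)).

(** r^s with the convention 0^s = 0 (used only for diameters). *)
Definition hpow (r s : R) : R := if Rle_dec r 0 then 0 else Rpower r s.

(** H^s(E) = 0, where H^s = sup_{delta>0} H^s_delta and
    H^s_delta(E) = inf { sum_k diam(U_k)^s : E ⊆ ∪ U_k, diam U_k <= delta }.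
    A bound r_k with diam U_k <= r_k <= delta stands for the diameter. *)
Definition Hnull (n : nat) (s : R) (E : Rn n -> Prop) : Prop :=
  forall delta eps : R, 0 < delta -> 0 < eps ->
  exists (U : nat -> Rn n -> Prop) (r : nat -> R),
    (forall k, 0 <= r k <= delta /\
               (forall x y, U k x -> U k y -> dist x y <= r k)) /\
    (forall x, E x -> exists k, U k x) /\
    (forall N, sum_f_R0 (fun k => hpow (r k) s) N <= eps).

Definition is_glb (S : R -> Prop) (m : R) : Prop :=
  (forall s, S s -> m <= s) /\ (forall m', (forall s, S s -> m' <= s) -> m' <= m).

Definition is_Hausdorff_dim (n : nat) (E : Rn n -> Prop) (d : R) : Prop :=
  is_glb (fun s => 0 <= s /\ Hnull n s E) d.

Definition subset_Nstar (Q : nat -> Prop) : Prop := forall q, Q q -> (1 <= q)%nat.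

Definition infinite_set (Q : nat -> Prop) : Prop := forall N, exists q, (N < q)%nat /\ Q q.

Definition complement_free (Q : nat -> Prop) : Prop :=
  forall q, (1 <= q)%nat ->
    (Q q <-> ~ exists v, (1 <= v)%nat /\ ~ Q v /\ Nat.divide v q).

Definition indic_term (Q : nat -> Prop) (nu : R) (q : nat) : R :=
  if excluded_middle_informative (Q q) then Rpower (INR q) (- nu) else 0.

Definition series_converges (Q : nat -> Prop) (nu : R) : Prop :=
  exists B, forall N, sum_f_R0 (indic_term Q nu) N <= B.

Definition is_conv_exponent (Q : nat -> Prop) (e : R) : Prop :=
  is_glb (fun nu => 0 < nu /\ series_converges Q nu) e.

Definition W (tau : R) (n : nat) (Q : nat -> Prop) (x : Rn n) : Prop :=
  forall N, exists q, (N < q)%nat /\ Q q /\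
    exists p : nat -> Z, forall i, (i < n)%nat ->
      Rabs (coord x i - IZR (p i) / INR q) < Rpower (INR q) (- tau).

Definition Nstar (q : nat) : Prop := (1 <= q)%nat.

Definition Wstar (tau : R) (n : nat) (Q : nat -> Prop) (x : Rn n) : Prop :=
  W tau n Nstar x /\ ~ W tau n Q x.

(* Main.v *)
From Stdlib Require Import Reals Lra Lia ZArith Arith Classical ClassicalEpsilon List FinFun Cantor.
Require Import Defs.
Open Scope R_scope.

(* Two facts give everything:
   dim [W_tau(Q)] <= (n + nu(Q)) / tau, by the obvious covers, and the Jarnik lower bound
   dim [W_tau] >= (n + 1) / tau. If nu(Q) < 1, then [W_tau] is the union of [W*] and of a set of
   smaller dimension. If nu(Q) = 1, fix [v] outside [Q]: rationals close to [1 / v] with large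
   denominator [q] must equal [1 / v], hence [v] divides [q] and [q] is outside [Q]; so
   [x |-> (x, 1 / v)] embeds the (n-1)-dimensional [W_tau'] isometrically into [W*] for every
   [tau' > tau], and n / tau follows from the Jarnik bound in dimension n - 1.

   For the Jarnik bound, let a cover of [W_tau] by sets of diameters [r_k] have small [sum r_k ^ s].
   Call a ball light if the cover sets touching it have mass small against [rho ^ s]. Dirichlet's
   theorem shows that a positive proportion of the cells of a grid of mesh [N ^ -(1 + 1/n)] in the
   ball lie near a rational point of denominator comparable to [N]; averaging over these cells
   produces a much smaller light ball centred at such a point. The common point of the nested
   light balls lies in [W_tau] and in no set of the cover. *)

(** * Counting in boxes of integer vectors *)

(** Decided by excluded middle, since the predicates counted below compare real numbers. *)
Fixpoint count (P : nat -> Prop) (M : nat) : nat :=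
  match M with
  | O => O
  | S M' => (count P M' + if excluded_middle_informative (P M') then 1 else 0)%nat
  end.

Lemma count_mono (P P' : nat -> Prop) (M : nat) :
  (forall c, (c < M)%nat -> P c -> P' c) -> (count P M <= count P' M)%nat.
Proof.
  induction M as [|M IH]; intros H; simpl; [lia|].
  assert (count P M <= count P' M)%nat by (apply IH; intros; apply H; auto).
  destruct (excluded_middle_informative (P M)) as [p|p];
    destruct (excluded_middle_informative (P' M)) as [p'|p']; try lia.
  exfalso; apply p'; apply H; auto.
Qed.

Lemma count_empty (P : nat -> Prop) (M : nat) :
  (forall c, (c < M)%nat -> ~ P c) -> count P M = O.
Proof.
  induction M as [|M IH]; intros H; simpl; auto.
  rewrite IH by (intros; apply H; lia).
  destruct (excluded_middle_informative (P M)) as [p|p]; auto.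
  exfalso; apply (H M); auto.
Qed.

Lemma count_or (P P' : nat -> Prop) (M : nat) :
  (count (fun c => P c \/ P' c) M <= count P M + count P' M)%nat.
Proof.
  induction M as [|M IH]; simpl; [lia|].
  destruct (excluded_middle_informative (P M \/ P' M));
    destruct (excluded_middle_informative (P M));
    destruct (excluded_middle_informative (P' M)); try lia; tauto.
Qed.

Lemma count_compl (P : nat -> Prop) (M : nat) :
  (count P M + count (fun c => ~ P c) M = M)%nat.
Proof.
  induction M as [|M IH]; simpl; [lia|].
  destruct (excluded_middle_informative (P M));
    destruct (excluded_middle_informative (~ P M)); try lia; tauto.
Qed.

Lemma count_exists (P : nat -> nat -> Prop) (K M : nat) (B : R) :
  (forall j, (j < K)%nat -> INR (count (P j) M) <= B) ->
  INR (count (fun c => exists j, (j < K)%nat /\ P j c) M) <= INR K * B.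
Proof.
  induction K as [|K IH]; intros H.
  - rewrite count_empty by (intros c _ (j & Hj & _); lia). simpl; lra.
  - assert (count (fun c => exists j, (j < S K)%nat /\ P j c) M <=
      count (fun c => exists j, (j < K)%nat /\ P j c) M + count (P K) M)%nat as HS.
    { etransitivity; [|apply count_or].
      apply count_mono; intros c _ [j [Hj Hc]].
      destruct (Nat.eq_dec j K); [subst; auto|left; exists j; split; auto; lia]. }
    apply le_INR in HS. rewrite plus_INR in HS. rewrite S_INR.
    specialize (IH ltac:(intros; apply H; lia)).
    specialize (H K ltac:(lia)). lra.
Qed.

Lemma count_add (P : nat -> Prop) (a b : nat) :
  count P (a + b) = (count P a + count (fun c => P (a + c)%nat) b)%nat.
Proof.
  induction b as [|b IH]; simpl.
  - rewrite Nat.add_0_r; lia.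
  - rewrite Nat.add_succ_r; simpl; rewrite IH; lia.
Qed.

(** The elements of [P] lie between a first and a last one, so there are at most as many as the
    difference of these two plus one. *)
Lemma count_span (P : nat -> Prop) (M : nat) (l : R) :
  0 <= l ->
  (forall a b, (a < M)%nat -> (b < M)%nat -> P a -> P b -> INR b - INR a <= l) ->
  INR (count P M) <= l + 1.
Proof.
  intros Hl H.
  assert (forall N, (N <= M)%nat -> count P N = O \/ exists a b, (a <= b)%nat /\ (b < N)%nat
            /\ P a /\ P b /\ (count P N <= b - a + 1)%nat) as K.
  { induction N as [|N IH]; intros HN; simpl; [auto|].
    destruct (excluded_middle_informative (P N)) as [p|p].
    - right. destruct (IH ltac:(lia)) as [E | (a & b & ? & ? & ? & ? & ?)].
      + exists N, N; repeat split; auto; lia.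
      + exists a, N; repeat split; auto; lia.
    - destruct (IH ltac:(lia)) as [E | (a & b & ? & ? & ? & ? & ?)]; [left; lia|].
      right; exists a, b; repeat split; auto; lia. }
  destruct (K M ltac:(lia)) as [E | (a & b & Hab & Hb & Pa & Pb & Hc)].
  - rewrite E; simpl; lra.
  - apply le_INR in Hc. rewrite plus_INR, minus_INR in Hc by lia. simpl in Hc.
    specialize (H a b ltac:(lia) Hb Pa Pb). lra.
Qed.

(** Base-[A] digits, least significant first: a number below [A ^ n] stands for a point of the box
    of side [A] in dimension [n], so that grid cells are counted as plain numbers. *)
Fixpoint digit (A i c : nat) : nat :=
  match i with O => (c mod A)%nat | S i' => digit A i' (c / A) end.

Lemma digit_lt (A i c : nat) : (1 <= A)%nat -> (digit A i c < A)%nat.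
Proof.
  intros HA; revert c; induction i as [|i IH]; intros c; simpl; auto.
  apply Nat.mod_upper_bound; lia.
Qed.

(** Euclidean division by [A] identifies the numbers below [A * M] with pairs; the induction adds
    one block of [A] consecutive numbers, on which the quotient is constant. *)
Lemma count_mod_div (P P' : nat -> Prop) (A M : nat) :
  (1 <= A)%nat ->
  count (fun c => P (c mod A)%nat /\ P' (c / A)%nat) (A * M) = (count P A * count P' M)%nat.
Proof.
  intros HA; induction M as [|M IH].
  - rewrite Nat.mul_0_r; simpl; lia.
  - replace (A * S M)%nat with (A * M + A)%nat by lia.
    rewrite count_add, IH; simpl.
    enough (count (fun c => P ((A * M + c) mod A)%nat /\ P' ((A * M + c) / A)%nat) A =
       (count P A * (if excluded_middle_informative (P' M) then 1 else 0))%nat) as -> by lia.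
    assert (forall N, (N <= A)%nat ->
      count (fun c => P ((A * M + c) mod A)%nat /\ P' ((A * M + c) / A)%nat) N =
       (count P N * (if excluded_middle_informative (P' M) then 1 else 0))%nat) as K; [|apply K; lia].
    induction N as [|N IHN]; intros HN; simpl; [lia|].
    rewrite IHN by lia.
    assert ((A * M + N) mod A = N)%nat as E1.
    { rewrite Nat.add_comm, Nat.mul_comm, Nat.Div0.mod_add. apply Nat.mod_small; lia. }
    assert ((A * M + N) / A = M)%nat as E2.
    { rewrite Nat.add_comm, Nat.mul_comm, Nat.div_add by lia.
      rewrite Nat.div_small by lia; lia. }
    rewrite E1, E2.
    destruct (excluded_middle_informative (P N));
      destruct (excluded_middle_informative (P' M));
      destruct (excluded_middle_informative (P N /\ P' M)); try lia; tauto.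
Qed.

(** The conditions on different digits are independent, so the count is a product of one-dimensional
    counts; each induction step splits off the lowest digit. *)
Lemma count_digits (n A : nat) (P : nat -> nat -> Prop) (T : R) :
  (1 <= A)%nat ->
  (forall i, (i < n)%nat -> INR (count (P i) A) <= T) ->
  INR (count (fun c => forall i, (i < n)%nat -> P i (digit A i c)) (A ^ n)) <= T ^ n.
Proof.
  intros HA; revert P; induction n as [|n IH]; intros P H.
  - simpl. destruct (excluded_middle_informative _); simpl; lra.
  - assert (count (fun c => forall i, (i < S n)%nat -> P i (digit A i c)) (A ^ S n) <=
      count (fun c => P O (c mod A)%nat /\
         (fun c' => forall i, (i < n)%nat -> P (S i) (digit A i c')) (c / A)%nat) (A * A ^ n))%nat as K.
    { simpl. apply count_mono; intros c _ Hc; split.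
      - apply (Hc O); lia.
      - intros i Hi; apply (Hc (S i)); lia. }
    rewrite count_mod_div in K by auto.
    apply le_INR in K. rewrite mult_INR in K.
    pose proof (H O ltac:(lia)) as H0.
    pose proof (IH (fun i => P (S i)) ltac:(intros; apply H; lia)) as H1.
    eapply Rle_trans; [exact K|]. simpl.
    apply Rmult_le_compat; auto using pos_INR.
Qed.

(** Interchange of summation: each cell of [G] receives total weight at least 1 from the sets
    touching it. The contrapositive yields a cell of weight below 1. *)
Lemma double_count (G : nat -> Prop) (t : nat -> nat -> Prop) (v : nat -> R) (K M : nat) :
  (forall c, (c < M)%nat -> G c ->
     1 <= sum_f_R0 (fun k => if excluded_middle_informative (t k c) then v k else 0) K) ->
  INR (count G M) <= sum_f_R0 (fun k => v k * INR (count (fun c => G c /\ t k c) M)) K.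
Proof.
  induction M as [|M IH]; intros H.
  - simpl. clear H. induction K; simpl; lra.
  - assert (sum_f_R0 (fun k => v k * INR (count (fun c => G c /\ t k c) (S M))) K =
      sum_f_R0 (fun k => v k * INR (count (fun c => G c /\ t k c) M)) K +
      sum_f_R0 (fun k => if excluded_middle_informative (G M /\ t k M) then v k else 0) K) as ->.
    { rewrite <- sum_plus. apply sum_eq; intros k _.
      cbn [count]. rewrite plus_INR.
      destruct (excluded_middle_informative (G M /\ t k M)); simpl; ring. }
    cbn [count]. rewrite plus_INR.
    apply Rplus_le_compat; [apply IH; intros; apply H; auto|].
    destruct (excluded_middle_informative (G M)) as [g|g].
    + simpl (INR 1). eapply Rle_trans; [apply (H M); auto|].
      apply Req_le, sum_eq; intros k _.
      destruct (excluded_middle_informative (t k M));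
        destruct (excluded_middle_informative (G M /\ t k M)); tauto.
    + simpl. apply Req_le; symmetry. apply sum_eq_R0; intros k _.
      destruct (excluded_middle_informative (G M /\ t k M)); tauto.
Qed.

(** * Dirichlet's theorem and ubiquity of rational points *)

Lemma pigeonhole (f : nat -> nat) (M : nat) :
  (forall j, (j <= M)%nat -> (f j < M)%nat) ->
  exists j j', (j < j')%nat /\ (j' <= M)%nat /\ f j = f j'.
Proof.
  intros Hf. apply NNPP; intros H.
  assert (NoDup (map f (seq 0 (S M)))) as ND.
  { apply Injective_map_NoDup_in; [|apply seq_NoDup].
    intros a b Ha Hb E. apply in_seq in Ha, Hb.
    destruct (lt_eq_lt_dec a b) as [[L|L]|L]; auto; exfalso; apply H.
    - exists a, b; repeat split; auto; lia.
    - exists b, a; repeat split; auto; lia. }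
  apply (NoDup_incl_length (l' := seq 0 M)) in ND.
  - rewrite length_map, !length_seq in ND; lia.
  - intros y Hy. apply in_map_iff in Hy as (a & <- & Ha). apply in_seq in Ha.
    apply in_seq. pose proof (Hf a). lia.
Qed.

(** Labels the [m ^ n] subcubes of side [1 / m] in the pigeonhole argument. *)
Fixpoint encode (m n : nat) (d : nat -> nat) : nat :=
  match n with O => O | S n' => (d n' + m * encode m n' d)%nat end.

Lemma encode_lt (m n : nat) (d : nat -> nat) :
  (forall i, (i < n)%nat -> (d i < m)%nat) -> (encode m n d < m ^ n)%nat.
Proof.
  induction n as [|n IH]; intros H; simpl; [lia|].
  pose proof (H n ltac:(lia)).
  assert (encode m n d < m ^ n)%nat by (apply IH; intros; apply H; lia). nia.
Qed.

Lemma encode_inj (m n : nat) (d d' : nat -> nat) :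
  (forall i, (i < n)%nat -> (d i < m)%nat /\ (d' i < m)%nat) ->
  encode m n d = encode m n d' -> forall i, (i < n)%nat -> d i = d' i.
Proof.
  induction n as [|n IH]; intros H E i Hi; simpl in *; [lia|].
  pose proof (H n ltac:(lia)) as [Hn Hn'].
  assert (encode m n d = encode m n d') by nia.
  destruct (Nat.eq_dec i n) as [->|]; [nia|].
  apply IH; auto; lia.
Qed.

(** Among the fractional parts of [j * x] for [j] from 0 to [m ^ n], two lie in the same subcube of
    side [1 / m]; [q] is the difference of their indices. *)
Lemma dirichlet (n m : nat) (x : nat -> R) :
  (1 <= m)%nat ->
  exists q, (1 <= q <= m ^ n)%nat /\ exists p : nat -> Z,
    forall i, (i < n)%nat -> Rabs (INR q * x i - IZR (p i)) < / INR m.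
Proof.
  intros Hm. assert (0 < INR m) as Hm' by (apply lt_0_INR; lia).
  set (fr := fun j i => INR j * x i - IZR (Int_part (INR j * x i))).
  set (b := fun j i => Z.to_nat (Int_part (INR m * fr j i))).
  assert (forall j i, 0 <= fr j i < 1) as Hfr.
  { intros j i; unfold fr. destruct (base_Int_part (INR j * x i)); lra. }
  assert (forall j i, INR (b j i) <= INR m * fr j i < INR (b j i) + 1) as Hb.
  { intros j i. unfold b. destruct (base_Int_part (INR m * fr j i)) as [H1 H2].
    assert (-1 < Int_part (INR m * fr j i))%Z.
    { apply lt_IZR. pose proof (Hfr j i).
      assert (0 <= INR m * fr j i) by nra. lra. }
    rewrite INR_IZR_INZ, Z2Nat.id by lia. lra. }
  assert (forall j i, (b j i < m)%nat) as Hbm.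
  { intros j i. apply INR_lt. pose proof (Hb j i). pose proof (Hfr j i). nra. }
  destruct (pigeonhole (fun j => encode m n (b j)) (m ^ n)) as (j & j' & Hj & Hj' & E).
  { intros; apply encode_lt; auto. }
  exists (j' - j)%nat; split; [lia|].
  exists (fun i => (Int_part (INR j' * x i) - Int_part (INR j * x i))%Z).
  intros i Hi. rewrite minus_INR, minus_IZR by lia.
  replace ((INR j' - INR j) * x i - (IZR (Int_part (INR j' * x i)) - IZR (Int_part (INR j * x i))))
    with (fr j' i - fr j i) by (unfold fr; ring).
  assert (b j i = b j' i) as Eb by (eapply encode_inj; eauto).
  pose proof (Hb j i). pose proof (Hb j' i). rewrite Eb in *.
  assert (INR m * / INR m = 1) by (field; lra).
  apply Rabs_def1; apply Rmult_lt_reg_l with (INR m); auto; nra.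
Qed.

Lemma nat_ceil (y : R) : 0 <= y -> exists k : nat, y < INR k <= y + 1.
Proof.
  intros Hy. exists (Z.to_nat (up y)).
  destruct (archimed y). assert (0 < up y)%Z by (apply lt_IZR; lra).
  rewrite INR_IZR_INZ, Z2Nat.id by lia. lra.
Qed.

(** The progression runs over a length of at most [theta * A], so at most [theta * A + 3] integers
    are relevant, and the window of length [2 * eta] about each contains at most
    [2 * eta / theta + 1] terms. *)
Lemma count_near_integers (theta beta eta : R) (A : nat) :
  0 < theta -> 0 < eta <= 1 ->
  INR (count (fun a => exists p : Z, Rabs (beta + theta * INR a - IZR p) < eta) A)
    <= (theta * INR A + 3) * (2 * eta / theta + 1).
Proof.
  intros Ht He.
  assert (0 <= 2 * eta / theta) as Hq by (apply Rle_mult_inv_pos; lra).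
  pose proof (pos_INR A) as HA.
  destruct (nat_ceil (theta * INR A + 2)) as [K HK]; [nra|].
  (* The floor of [beta]: as [eta <= 1], no smaller integer comes within [eta] of a term. *)
  set (p0 := (up beta - 1)%Z).
  set (P := fun j a => Rabs (beta + theta * INR a - IZR (p0 + Z.of_nat j)) < eta).
  assert (forall j, INR (count (P j) A) <= 2 * eta / theta + 1) as HP.
  { intros j. apply count_span; auto.
    unfold P; intros a b _ _ Ha Hb.
    apply Rabs_def2 in Ha, Hb.
    apply Rmult_le_reg_l with theta; auto.
    replace (theta * (2 * eta / theta)) with (2 * eta) by (field; lra). lra. }
  eapply Rle_trans;
    [|eapply Rle_trans; [exact (count_exists P K A _ (fun j _ => HP j))|]].
  - apply le_INR, count_mono. intros a Ha [p Hp].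
    pose proof (Rabs_def2 _ _ Hp). destruct (archimed beta).
    apply lt_INR in Ha. pose proof (pos_INR a).
    assert (0 <= theta * INR a <= theta * INR A) by nra.
    assert (p0 <= p)%Z as Hp0.
    { unfold p0. assert (up beta - 2 < p)%Z; [|lia]. apply lt_IZR. rewrite minus_IZR. lra. }
    exists (Z.to_nat (p - p0)). split.
    + apply INR_lt. rewrite INR_IZR_INZ, Z2Nat.id by lia.
      unfold p0; rewrite !minus_IZR. lra.
    + unfold P. rewrite Z2Nat.id by lia. replace (p0 + (p - p0))%Z with p by lia. auto.
  - apply Rmult_le_compat_r; lra.
Qed.

Lemma pow_ge_base (x : R) (n : nat) : 1 <= x -> (1 <= n)%nat -> x <= x ^ n.
Proof.
  intros Hx Hn. destruct n as [|n]; [lia|]. simpl.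
  pose proof (pow_R1_Rle x n Hx). nra.
Qed.

(** For a fixed denominator [j] the condition splits into coordinates, each asking a progression of
    step [j / m ^ (n + 1)] to come within [1 / m] of an integer. The bound [j <= m ^ n] absorbs the
    [+ 1] of the one-dimensional count. *)
Lemma count_approximable (n m A j : nat) (b : nat -> R) :
  (1 <= A)%nat -> (1 <= m)%nat -> (1 <= j)%nat -> INR j <= INR m ^ n ->
  INR (count (fun c => exists p : nat -> Z, forall i, (i < n)%nat ->
      Rabs (INR j * (b i + INR (digit A i c) / INR m ^ (n + 1)) - IZR (p i)) < / INR m) (A ^ n))
  <= (3 * INR A / INR m + 9 * INR m ^ n / INR j) ^ n.
Proof.
  intros HA Hm Hj Hjm.
  assert (1 <= INR m) as Hm' by (apply (le_INR 1); auto).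
  assert (1 <= INR j) as Hj' by (apply (le_INR 1); auto).
  assert (1 <= INR A) as HA' by (apply (le_INR 1); auto).
  set (Y := INR m ^ n) in *.
  assert (INR m ^ (n + 1) = INR m * Y) as HD by (unfold Y; rewrite pow_add; simpl; ring).
  rewrite HD.
  set (P := fun i a => exists p : Z, Rabs (INR j * b i + INR j / (INR m * Y) * INR a - IZR p) < / INR m).
  eapply Rle_trans; [|apply (count_digits n A P)]; auto.
  - apply le_INR, count_mono. intros c _ [p Hp] i Hi. exists (p i).
    specialize (Hp i Hi).
    replace (INR j * b i + INR j / (INR m * Y) * INR (digit A i c))
      with (INR j * (b i + INR (digit A i c) / (INR m * Y))) by (field; split; lra). auto.
  - intros i _. unfold P. eapply Rle_trans; [apply count_near_integers|].
    + apply Rdiv_lt_0_compat; nra.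
    + split; [apply Rinv_0_lt_compat; lra|]. rewrite <- Rinv_1. apply Rinv_le_contravar; lra.
    + replace (3 * INR A / INR m + 9 * Y / INR j) with
       ((INR j / (INR m * Y) * INR A + 3) * (3 * Y / INR j)) by (field; lra).
      apply Rmult_le_compat_l.
      * assert (0 <= INR j / (INR m * Y) * INR A); [|lra].
        apply Rmult_le_pos; [|lra]. apply Rle_mult_inv_pos; nra.
      * replace (2 * / INR m / (INR j / (INR m * Y))) with (2 * Y / INR j) by (field; lra).
        assert (1 <= Y / INR j).
        { apply Rmult_le_reg_r with (INR j); [lra|]. field_simplify; lra. }
        unfold Rdiv in *. nra.
Qed.

(* Cells whose Dirichlet denominator is below [l ^ n] make up at most half of the grid: the
   denominators below [q1] contribute a lower order term, the others a proportion [4 ^ -n] of it. *)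
Lemma ubiquity (n l A q1 : nat) (b : nat -> R) (rho : R) :
  let m := (24 * l)%nat in
  let D := INR m ^ (n + 1) in
  (1 <= n)%nat -> (1 <= l)%nat -> 0 < rho <= 1 -> (1 <= A)%nat ->
  rho * D / 8 <= INR A <= rho * D / 4 ->
  24 / rho <= INR q1 -> 48 * INR q1 <= rho * INR m / 8 ->
  INR A ^ n / 2 <= INR (count (fun c => exists q, (l ^ n <= q <= m ^ n)%nat /\
     exists p : nat -> Z, forall i, (i < n)%nat ->
       Rabs (b i + INR (digit A i c) / D - IZR (p i) / INR q) <= 24 ^ n / D) (A ^ n)).
Proof.
  intros m D Hn Hl Hr HA HAD Hq1 Hq1'.
  assert (1 <= INR l) as Hl' by (apply (le_INR 1); auto).
  assert (1 <= INR A) as HA' by (apply (le_INR 1); auto).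
  assert (INR m = 24 * INR l) as Em by (unfold m; rewrite mult_INR; simpl; ring).
  set (Y := INR m ^ n).
  assert (INR m <= Y) as HmY by (apply pow_ge_base; auto; lra).
  assert (D = INR m * Y) as HD by (unfold D, Y; rewrite pow_add; simpl; ring).
  assert (Y = 24 ^ n * INR l ^ n) as EY by (unfold Y; rewrite Em, Rpow_mult_distr; auto).
  assert (1 <= INR q1) as Hq1''.
  { assert (1 <= 24 / rho); [|lra]. apply Rmult_le_reg_r with rho; [lra|]. field_simplify; lra. }
  assert (INR q1 <= INR m) as Hq1m by nra.
  set (near := fun j c => exists p : nat -> Z, forall i, (i < n)%nat ->
     Rabs (INR j * (b i + INR (digit A i c) / D) - IZR (p i)) < / INR m).
  set (good := fun c => exists q, (l ^ n <= q <= m ^ n)%nat /\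
     exists p : nat -> Z, forall i, (i < n)%nat ->
       Rabs (b i + INR (digit A i c) / D - IZR (p i) / INR q) <= 24 ^ n / D).
  set (bad1 := fun c => exists j, (j < q1)%nat /\ ((1 <= j)%nat /\ near j c)).
  set (bad2 := fun c => exists j, (j < l ^ n)%nat /\ ((q1 <= j)%nat /\ near j c)).
  assert (forall j, (1 <= j)%nat -> INR j <= Y ->
     INR (count (near j) (A ^ n)) <= (3 * INR A / INR m + 9 * Y / INR j) ^ n) as Hnear.
  { intros j Hj HjY. apply count_approximable; auto. unfold m; lia. }
  assert (0 <= INR A / INR m) as HAm by (apply Rle_mult_inv_pos; lra).
  assert (INR A / INR m * INR m = INR A) as HAm1 by (field; lra).
  assert (INR A / INR m <= Y) as HAm2.
  { apply Rmult_le_reg_r with (INR m); [lra|]. rewrite HAm1. nra. }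
  assert (rho * Y / 8 <= INR A / INR m) as HAm3.
  { apply Rmult_le_reg_r with (INR m); [lra|]. rewrite HAm1. nra. }
  (* Each denominator below [q1] accounts for at most [(12 * Y) ^ n] cells since [A / m <= Y], and
     [48 * q1 * Y <= A] bounds all of them together by a quarter of the grid. *)
  assert (INR A ^ n / 4 >= INR (count bad1 (A ^ n))) as H1.
  { apply Rle_ge. eapply Rle_trans;
      [apply (count_exists (fun j c => (1 <= j)%nat /\ near j c) q1 _ ((12 * Y) ^ n))|].
    - intros j Hj. destruct (Nat.eq_dec j 0) as [->|Hj0].
      + rewrite count_empty by (intros c _ [? _]; lia). apply pow_le; lra.
      + eapply Rle_trans; [apply le_INR, count_mono; intros c _ [_ Hc]; exact Hc|].
        apply lt_INR in Hj.
        assert (1 <= INR j) as Hj1 by (apply (le_INR 1); lia).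
        eapply Rle_trans; [apply Hnear; [lia|lra]|].
        assert (0 <= Y / INR j <= Y) as HYj.
        { split; [apply Rle_mult_inv_pos; lra|].
          apply Rmult_le_reg_r with (INR j); [lra|]. field_simplify; nra. }
        apply pow_incr. unfold Rdiv in *. split; nra.
    - assert (INR q1 * (12 * Y) ^ n <= (48 * INR q1 * Y) ^ n / 4).
      { replace (48 * INR q1 * Y) with (4 * INR q1 * (12 * Y)) by ring.
        rewrite (Rpow_mult_distr (4 * INR q1) (12 * Y)).
        pose proof (pow_ge_base (4 * INR q1) n ltac:(lra) Hn).
        assert (0 <= (12 * Y) ^ n) by (apply pow_le; lra). nra. }
      assert ((48 * INR q1 * Y) ^ n <= INR A ^ n); [|lra].
      apply pow_incr; split; nra. }
  (* For [j >= q1 >= 24 / rho] the term [9 * Y / j] is at most [3 * A / m], so each denominator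
     accounts for at most [(6 * A / m) ^ n] cells. With [m = 24 * l], the [l ^ n] denominators give
     at most [(A / 4) ^ n]; the factor 24 is chosen for this. *)
  assert (INR A ^ n / 4 >= INR (count bad2 (A ^ n))) as H2.
  { apply Rle_ge. eapply Rle_trans;
      [apply (count_exists (fun j c => (q1 <= j)%nat /\ near j c) _ _ ((6 * (INR A / INR m)) ^ n))|].
    - intros j Hj. destruct (le_lt_dec q1 j) as [Hqj|Hqj].
      + eapply Rle_trans; [apply le_INR, count_mono; intros c _ [_ Hc]; exact Hc|].
        apply lt_INR in Hj. rewrite pow_INR in Hj. apply le_INR in Hqj.
        assert (1 <= 24 ^ n) by (apply pow_R1_Rle; lra).
        assert (0 <= INR l ^ n) by (apply pow_le; lra).
        eapply Rle_trans; [apply Hnear|].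
        * apply INR_le; simpl; lra.
        * nra.
        * assert (0 <= Y / INR j <= rho * Y / 24) as HYj.
          { split; [apply Rle_mult_inv_pos; lra|].
            apply Rmult_le_reg_r with (INR j); [lra|].
            replace (Y / INR j * INR j) with Y by (field; lra).
            assert (24 <= rho * INR j); [|nra].
            apply Rmult_le_reg_l with (/ rho); [apply Rinv_0_lt_compat; lra|].
            field_simplify; lra. }
          apply pow_incr. unfold Rdiv in *. split; nra.
      + rewrite count_empty by (intros c _ [? _]; lia). apply pow_le; lra.
    - rewrite pow_INR, <- Rpow_mult_distr, Em.
      replace (INR l * (6 * (INR A / (24 * INR l)))) with (INR A * / 4) by (field; lra).
      rewrite Rpow_mult_distr. assert (0 < INR A ^ n) by (apply pow_lt; lra).
      assert ((/ 4) ^ n <= / 4); [|nra].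
      rewrite pow_inv. apply Rinv_le_contravar; [lra|]. apply pow_ge_base; auto; lra. }
  (* On the remaining cells the Dirichlet denominator is at least [l ^ n], so the error
     [1 / (m * q)] is at most [1 / (m * l ^ n) = 24 ^ n / D]. *)
  assert (count (fun c => ~ (bad1 c \/ bad2 c)) (A ^ n) <= count good (A ^ n))%nat as Hgood.
  { apply count_mono. intros c _ Hc.
    destruct (dirichlet n m (fun i => b i + INR (digit A i c) / D)) as (q & Hq & p & Hp).
    { unfold m; lia. }
    assert (l ^ n <= q)%nat as Hlq.
    { apply Nat.nlt_ge; intros Hlt. apply Hc.
      destruct (le_lt_dec q1 q); [right|left]; exists q; repeat split; try lia; exists p; auto. }
    exists q; split; [lia|]. exists p; intros i Hi. specialize (Hp i Hi); cbn beta in Hp.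
    assert (1 <= INR q) as Hq' by (apply (le_INR 1); lia).
    apply le_INR in Hlq. rewrite pow_INR in Hlq.
    replace (b i + INR (digit A i c) / D - IZR (p i) / INR q) with
      ((INR q * (b i + INR (digit A i c) / D) - IZR (p i)) / INR q)
      by (field; split; [lra|rewrite HD; nra]).
    unfold Rdiv. rewrite Rabs_mult, (Rabs_pos_eq (/ INR q)) by (left; apply Rinv_0_lt_compat; lra).
    assert (0 < INR l ^ n) by (apply pow_lt; lra).
    replace (24 ^ n * / D) with (/ INR m * / INR l ^ n).
    2:{ rewrite HD, EY. field. repeat split; try lra. apply pow_nonzero; lra. }
    apply Rmult_le_compat; try lra; [apply Rabs_pos|left; apply Rinv_0_lt_compat; lra|].
    apply Rinv_le_contravar; lra. }
  apply le_INR in Hgood.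
  pose proof (count_compl (fun c => bad1 c \/ bad2 c) (A ^ n)) as HC.
  apply (f_equal INR) in HC. rewrite plus_INR, pow_INR in HC.
  pose proof (le_INR _ _ (count_or bad1 bad2 (A ^ n))) as HO. rewrite plus_INR in HO.
  lra.
Qed.

(** * Light balls and the lower bound *)

(** Among finitely many candidates, one that fails at some [K0] fails from there on and can be
    discarded. This replaces a cell depending on the length [K] of a partial sum by one cell good
    for all [K]. *)
Lemma uniform_witness (M : nat) (P : nat -> nat -> Prop) :
  (forall c K K', (K <= K')%nat -> P c K' -> P c K) ->
  (forall K, exists c, (c < M)%nat /\ P c K) ->
  exists c, (c < M)%nat /\ forall K, P c K.
Proof.
  intros Hm. induction M as [|M IH]; intros H.
  - destruct (H O) as (c & ? & _); lia.
  - destruct (classic (forall K, P M K)) as [|N]; [exists M; auto|].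
    apply not_all_ex_not in N as [K0 HK0].
    destruct IH as (c & Hc & HP).
    + intros K. destruct (H (Nat.max K K0)) as (c & Hc & HP).
      destruct (Nat.eq_dec c M) as [->|].
      * exfalso; apply HK0. eapply Hm; [|exact HP]; lia.
      * exists c; split; [lia|]. eapply Hm; [|exact HP]; lia.
    + exists c; auto.
Qed.

Lemma sum_nonneg (f : nat -> R) (K : nat) :
  (forall k, 0 <= f k) -> 0 <= sum_f_R0 f K.
Proof. intros H; induction K; simpl; [auto|pose proof (H (S K)); lra]. Qed.

Lemma term_le_sum (f : nat -> R) (k K : nat) :
  (forall k, 0 <= f k) -> (k <= K)%nat -> f k <= sum_f_R0 f K.
Proof.
  intros H Hk; induction K as [|K IH]; simpl.
  - replace k with O by lia; lra.
  - pose proof (H (S K)). destruct (Nat.eq_dec k (S K)) as [->|].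
    + pose proof (sum_nonneg f K H); lra.
    + pose proof (IH ltac:(lia)); lra.
Qed.

Lemma sum_mono (f : nat -> R) (K K' : nat) :
  (forall k, 0 <= f k) -> (K <= K')%nat -> sum_f_R0 f K <= sum_f_R0 f K'.
Proof.
  intros H Hk; induction Hk; [lra|]. simpl. pose proof (H (S m)); lra.
Qed.

Lemma Rabs_le_bounds (x a : R) : Rabs x <= a -> - a <= x <= a.
Proof. unfold Rabs; destruct (Rcase_abs x); lra. Qed.

Lemma Rpower_gt0 (x y : R) : 0 < Rpower x y.
Proof. apply exp_pos. Qed.

Lemma Rpower_lt_mono (x y s : R) : 0 < s -> 0 < x < y -> Rpower x s < Rpower y s.
Proof.
  intros Hs [Hx Hy]. unfold Rpower. apply exp_increasing, Rmult_lt_compat_l; auto.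
  apply ln_increasing; auto.
Qed.

Lemma Rpower_le_reg (x y s : R) : 0 < s -> 0 < x -> 0 < y -> Rpower x s <= Rpower y s -> x <= y.
Proof.
  intros Hs Hx Hy H. apply Rnot_lt_le; intros L.
  pose proof (Rpower_lt_mono y x s Hs (conj Hy L)). lra.
Qed.

(** Sup norm rather than Euclidean: boxes factor into coordinates, as the digit counts require. *)
Definition within (n : nat) (x y : nat -> R) (rho : R) : Prop :=
  forall i, (i < n)%nat -> Rabs (x i - y i) <= rho.

Definition touches (n : nat) (V : nat -> (nat -> R) -> Prop) (y : nat -> R) (rho : R) (k : nat) : Prop :=
  exists x, V k x /\ within n x y rho.

(** A partial sum up to [K]; bounds on the whole mass quantify over [K]. *)
Definition touch_mass (n : nat) (s : R) (V : nat -> (nat -> R) -> Prop) (r : nat -> R)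
    (y : nat -> R) (rho : R) (K : nat) : R :=
  sum_f_R0 (fun k => if excluded_middle_informative (touches n V y rho k)
                     then Rpower (r k) s else 0) K.

(** On a grid of mesh [1 / D], a set of diameter [r] touches at most [r * D + 4 * 24 ^ n + 1] cells
    per direction, which is at most [packing_const n] times the maximum of 1 and [r * D]. *)
Definition packing_const (n : nat) : R := 6 * 24 ^ n.

(* The cover sets touching the ball carry too little mass to cover it; in particular each of them
   is smaller than the ball. *)
Definition light (n : nat) (s : R) (V : nat -> (nat -> R) -> Prop) (r : nat -> R)
    (y : nat -> R) (rho : R) : Prop :=
  forall K, touch_mass n s V r y rho K <= Rpower (rho / (32 * packing_const n)) s.

Lemma touches_sub (n : nat) V (y z : nat -> R) (rho rho' : R) (k : nat) :
  (forall i, (i < n)%nat -> Rabs (z i - y i) + rho' <= rho) ->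
  touches n V z rho' k -> touches n V y rho k.
Proof.
  intros H (x & Hx & Hw). exists x; split; auto. intros i Hi.
  specialize (H i Hi). specialize (Hw i Hi).
  replace (x i - y i) with ((x i - z i) + (z i - y i)) by ring.
  pose proof (Rabs_triang (x i - z i) (z i - y i)). lra.
Qed.

(** If the set meets the ball attached to a cell, the corner of the cell is within [d / D] of the
    set in every coordinate; hence the possible digits in one coordinate span at most
    [r * D + 2 * d]. *)
Lemma count_touched (n A : nat) (D d : R) (V : (nat -> R) -> Prop) (r : R) (b : nat -> R)
    (G : nat -> Prop) (z : nat -> nat -> R) (rho : R) :
  (1 <= A)%nat -> 0 < D -> 0 <= r -> 0 <= d ->
  (forall x y, V x -> V y -> within n x y r) ->
  (forall c i, G c -> (i < n)%nat -> Rabs (b i + INR (digit A i c) / D - z c i) + rho <= d / D) ->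
  INR (count (fun c => G c /\ exists x, V x /\ within n x (z c) rho) (A ^ n)) <= (r * D + 2 * d + 1) ^ n.
Proof.
  intros HA HD Hr Hd Hdiam HG.
  set (P := fun i a => exists x, V x /\ Rabs (x i - (b i + INR a / D)) <= d / D).
  eapply Rle_trans; [|apply (count_digits n A P)]; auto.
  - apply le_INR, count_mono. intros c _ [Hc (x & Hx & Hw)] i Hi.
    exists x; split; auto. specialize (HG c i Hc Hi). specialize (Hw i Hi).
    replace (x i - (b i + INR (digit A i c) / D)) with
      ((x i - z c i) - (b i + INR (digit A i c) / D - z c i)) by ring.
    pose proof (Rabs_triang (x i - z c i) (- (b i + INR (digit A i c) / D - z c i))).
    rewrite Rabs_Ropp in H. unfold Rminus in *. lra.
  - intros i Hi. apply count_span; [nra|].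
    intros a a' _ _ (x & Hx & Ha) (x' & Hx' & Ha').
    pose proof (Hdiam x' x Hx' Hx i Hi) as Hd'.
    apply Rabs_le_bounds in Ha, Ha', Hd'.
    assert (INR a' / D - INR a / D <= r + 2 * (d / D)) as K by lra.
    apply Rmult_le_compat_r with (r := D) in K; [|lra].
    field_simplify in K; lra.
Qed.

Lemma packing_const_ge (n : nat) : 6 <= packing_const n.
Proof.
  unfold packing_const. pose proof (pow_R1_Rle 24 n ltac:(lra)). lra.
Qed.

(* Every cover set of diameter at least [1 / D] gets weight 1, so a cell of total weight below 1
   is touched only by smaller sets; the weight of the smaller ones is their mass relative to the
   mass allowed in a light subball. *)
Lemma light_cell (n A : nat) (s rho rho' D : R) (V : nat -> (nat -> R) -> Prop) (r y b : nat -> R)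
    (G : nat -> Prop) (z : nat -> nat -> R) :
  (1 <= n)%nat -> 0 < s <= INR n -> (forall k, 0 < r k) ->
  (forall k x x', V k x -> V k x' -> within n x x' (r k)) ->
  0 < rho -> 0 < rho' -> 0 < D -> (1 <= A)%nat -> rho * D / 8 <= INR A ->
  (forall c i, G c -> (i < n)%nat ->
     Rabs (b i + INR (digit A i c) / D - z c i) + rho' <= 2 * 24 ^ n / D) ->
  (forall c i, (c < A ^ n)%nat -> G c -> (i < n)%nat -> Rabs (z c i - y i) + rho' <= rho) ->
  INR A ^ n / 2 <= INR (count G (A ^ n)) ->
  packing_const n ^ n * Rpower (rho / rho') s < (rho * D / 8) ^ n / 4 ->
  light n s V r y rho ->
  exists c, (c < A ^ n)%nat /\ G c /\ light n s V r (z c) rho'.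
Proof.
  intros Hn Hs Hr Hdiam Hrho Hrho' HD HA HAD HG Hsub HcG Hgrow Hlight.
  pose proof (packing_const_ge n) as HC.
  assert (1 <= 24 ^ n) as H24 by (apply pow_R1_Rle; lra).
  set (C := packing_const n) in *.
  set (lam := fun t => t / (32 * C)).
  assert (forall t, 0 < t -> 0 < lam t) as Hlam by (intros; apply Rdiv_lt_0_compat; lra).
  set (w := fun k => Rpower (r k) s).
  set (v := fun k => if Rle_dec 1 (r k * D) then 1 else w k / Rpower (lam rho') s).
  assert (forall k, 0 < w k) as Hw by (intros; apply Rpower_gt0).
  assert (forall k, 0 < v k) as Hv.
  { intros k; unfold v; destruct (Rle_dec 1 (r k * D)); [lra|].
    apply Rdiv_lt_0_compat; auto using Rpower_gt0. }
  assert (forall c K K', (K <= K')%nat -> touch_mass n s V r (z c) rho' K <= touch_mass n s V r (z c) rho' K')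
    as Hmono.
  { intros c K K' HK. apply sum_mono; auto. intros k.
    destruct (excluded_middle_informative _); [left; apply Rpower_gt0|lra]. }
  (* Partial masses grow with [K], so a cell for each [K] suffices. *)
  destruct (uniform_witness (A ^ n)
    (fun c K => G c /\ touch_mass n s V r (z c) rho' K <= Rpower (lam rho') s)) as (c & Hc & HP).
  { intros c K K' HK [Hg Hm]; split; auto. eapply Rle_trans; [apply Hmono; exact HK|exact Hm]. }
  2:{ exists c; split; auto. split; [apply (HP O)|]. intros K; apply (HP K). }
  intros K.
  set (F := fun c => sum_f_R0 (fun k =>
    if excluded_middle_informative (touches n V (z c) rho' k) then v k else 0) K).
  assert (forall c k, 0 <= (if excluded_middle_informative (touches n V (z c) rho' k) then v k else 0)) as HF0.
  { intros c k; destruct (excluded_middle_informative _); [left; auto|lra]. }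
  (* Otherwise every cell of [G] has weight at least 1, and double counting bounds [count G] by the
     total incidence weight, which turns out to be below half of the grid. *)
  assert (exists c, (c < A ^ n)%nat /\ G c /\ F c < 1) as (c & Hc & Hg & HF).
  { apply NNPP; intros Hno.
    assert (INR (count G (A ^ n)) <= sum_f_R0 (fun k => v k *
      INR (count (fun c => G c /\ touches n V (z c) rho' k) (A ^ n))) K) as Hdc.
    { apply double_count. intros c Hc Hg. apply Rnot_lt_le; intros HF.
      apply Hno; exists c; auto. }
    (* Incidence weight per unit of mass: the first summand serves the big sets, via
       [r ^ n = r ^ s * r ^ (n - s)] and [r <= lam rho], the second the small ones. *)
    set (X := Rpower (lam rho) (INR n - s) * (C * D) ^ n + C ^ n / Rpower (lam rho') s).
    assert (sum_f_R0 (fun k => v k *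
      INR (count (fun c => G c /\ touches n V (z c) rho' k) (A ^ n))) K
      <= X * touch_mass n s V r y rho K) as Hsum.
    { unfold touch_mass. rewrite scal_sum. apply sum_Rle. intros k Hk.
      destruct (excluded_middle_informative (touches n V y rho k)) as [Ht|Ht].
      2:{ rewrite count_empty; [simpl; lra|]. intros c Hc [Hg Htc]. apply Ht.
          eapply touches_sub; [|exact Htc]. intros; apply Hsub; auto. }
      pose proof (count_touched n A D (2 * 24 ^ n) (V k) (r k) b G z rho' HA HD
        (Rlt_le _ _ (Hr k)) ltac:(lra) (Hdiam k) HG) as Hct.
      fold (w k).
      assert (INR (count (fun c => G c /\ touches n V (z c) rho' k) (A ^ n))
        <= (r k * D + 2 * (2 * 24 ^ n) + 1) ^ n) as Hct' by exact Hct.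
      clear Hct. pose proof (Hr k) as Hrk. pose proof (Hw k) as Hwk.
      assert (0 < r k * D) as HrD by nra.
      assert (0 < C ^ n) by (apply pow_lt; lra).
      assert (0 < (C * D) ^ n) by (apply pow_lt; nra).
      pose proof (Rpower_gt0 (lam rho) (INR n - s)).
      assert (0 < C ^ n / Rpower (lam rho') s) by (apply Rdiv_lt_0_compat; auto using Rpower_gt0).
      unfold v. destruct (Rle_dec 1 (r k * D)) as [Hbig|Hsmall].
      (* A single term of the mass is bounded by the mass allowed in a light ball. *)
      - assert (r k <= lam rho) as Hrl.
        { apply Rpower_le_reg with s; auto; [lra|].
          eapply Rle_trans; [|apply (Hlight K)].
          unfold touch_mass.
          pose proof (term_le_sum (fun k => if excluded_middle_informative (touches n V y rho k)
                     then Rpower (r k) s else 0) k K) as Hle.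
          cbn beta in Hle. destruct (excluded_middle_informative (touches n V y rho k)); [|tauto].
          apply Hle; auto. intros j; destruct (excluded_middle_informative _);
            [left; apply Rpower_gt0|lra]. }
        assert ((r k * D + 2 * (2 * 24 ^ n) + 1) ^ n <= (C * D) ^ n * (r k) ^ n) as Hp1.
        { rewrite <- Rpow_mult_distr. apply pow_incr. unfold C, packing_const in *. nra. }
        assert ((r k) ^ n <= w k * Rpower (lam rho) (INR n - s)) as Hp2.
        { rewrite <- Rpower_pow by auto. unfold w.
          replace (INR n) with (s + (INR n - s)) at 1 by ring. rewrite Rpower_plus.
          apply Rmult_le_compat_l; [left; apply Rpower_gt0|].
          apply Rle_Rpower_l; lra. }
        rewrite Rmult_1_l. eapply Rle_trans; [exact Hct'|]. eapply Rle_trans; [exact Hp1|].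
        apply Rle_trans with ((C * D) ^ n * (w k * Rpower (lam rho) (INR n - s))).
        + apply Rmult_le_compat_l; lra.
        + unfold X. nra.
      - assert ((r k * D + 2 * (2 * 24 ^ n) + 1) ^ n <= C ^ n) as Hp1.
        { apply pow_incr. unfold C, packing_const in *. nra. }
        assert (0 < w k / Rpower (lam rho') s) by (apply Rdiv_lt_0_compat; auto using Rpower_gt0).
        apply Rle_trans with (w k / Rpower (lam rho') s * C ^ n).
        + apply Rmult_le_compat_l; lra.
        + replace (w k / Rpower (lam rho') s * C ^ n) with (w k * (C ^ n / Rpower (lam rho') s))
            by (unfold Rdiv; ring).
          unfold X. apply Rmult_le_compat_l; [lra|].
          assert (0 < Rpower (lam rho) (INR n - s) * (C * D) ^ n) by (apply Rmult_lt_0_compat; auto).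
          lra. }
    assert (X * touch_mass n s V r y rho K <= X * Rpower (lam rho) s) as HX.
    { apply Rmult_le_compat_l; [|apply Hlight]. unfold X.
      assert (0 < (C * D) ^ n) by (apply pow_lt; nra).
      assert (0 < C ^ n) by (apply pow_lt; lra).
      pose proof (Rpower_gt0 (lam rho) (INR n - s)).
      assert (0 < C ^ n / Rpower (lam rho') s) by (apply Rdiv_lt_0_compat; auto using Rpower_gt0).
      nra. }
    (* The 32 in [light] makes the first term at most a quarter of [(rho * D / 8) ^ n]; the growth
       hypothesis makes the second one less than a quarter. *)
    assert (X * Rpower (lam rho) s = (rho * D / 32) ^ n + C ^ n * Rpower (rho / rho') s) as HXe.
    { unfold X. rewrite Rmult_plus_distr_r. f_equal.
      - replace (Rpower (lam rho) (INR n - s) * (C * D) ^ n * Rpower (lam rho) s) with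
          ((C * D) ^ n * (Rpower (lam rho) s * Rpower (lam rho) (INR n - s))) by ring.
        rewrite <- Rpower_plus. replace (s + (INR n - s)) with (INR n) by ring.
        rewrite Rpower_pow, <- Rpow_mult_distr by auto. f_equal. unfold lam. field; lra.
      - replace (lam rho) with (lam rho' * (rho / rho')) by (unfold lam; field; lra).
        rewrite <- Rpower_mult_distr by (auto; apply Rdiv_lt_0_compat; lra).
        field. apply Rgt_not_eq, Rpower_gt0. }
    assert ((rho * D / 32) ^ n <= (rho * D / 8) ^ n / 4) as H32.
    { replace (rho * D / 32) with (rho * D / 8 * / 4) by field.
      rewrite Rpow_mult_distr. assert (0 < (rho * D / 8) ^ n) by (apply pow_lt; nra).
      assert ((/ 4) ^ n <= / 4); [|nra].
      rewrite pow_inv. apply Rinv_le_contravar; [lra|]. apply pow_ge_base; auto; lra. }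
    assert ((rho * D / 8) ^ n <= INR A ^ n) by (apply pow_incr; split; nra).
    lra. }
  exists c; split; auto. split; auto.
  (* As [F c < 1], no touching set has weight 1, so all of them are small and their mass is the
     allowed mass times [F c]. *)
  apply Rle_trans with (Rpower (lam rho') s * F c).
  2:{ pose proof (Rpower_gt0 (lam rho') s). nra. }
  unfold F, touch_mass. rewrite scal_sum. apply sum_Rle. intros k Hk.
  destruct (excluded_middle_informative (touches n V (z c) rho' k)) as [Ht|Ht]; [|lra].
  pose proof (term_le_sum _ k K (HF0 c) Hk) as Hle. cbn beta in Hle. fold (F c) in Hle.
  destruct (excluded_middle_informative (touches n V (z c) rho' k)); [|tauto].
  unfold v in *. destruct (Rle_dec 1 (r k * D)); [lra|].
  apply Req_le. unfold w. field. apply Rgt_not_eq, Rpower_gt0.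
Qed.

(** Choice of scale for [light_cell]. With [Y = m ^ n] and [D = m ^ (n + 1)], the grid has about
    [(rho * D) ^ n] cells, of order [Y ^ (n + 1)], while [(rho / rho') ^ s] is of order
    [Y ^ (tau * s)]: by [s * tau < n + 1] the cells win for large [Y]. The condition
    [n + 1 < n * tau] keeps [rho'] below the mesh. *)
Lemma light_descent (n : nat) (s tau rho : R) (V : nat -> (nat -> R) -> Prop) (r y : nat -> R) (N : nat) :
  (1 <= n)%nat -> 0 < s -> s * tau < INR n + 1 -> INR n + 1 < INR n * tau ->
  (forall k, 0 < r k) ->
  (forall k x x', V k x -> V k x' -> within n x x' (r k)) ->
  0 < rho <= 1 -> light n s V r y rho ->
  exists (q : nat) (p : nat -> Z) (rho' : R),
    (N < q)%nat /\ 0 < rho' <= rho / 2 /\ rho' < Rpower (INR q) (- tau) /\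
    (forall i, (i < n)%nat -> Rabs (IZR (p i) / INR q - y i) + rho' <= rho) /\
    light n s V r (fun i => IZR (p i) / INR q) rho'.
Proof.
  intros Hn Hs Hst Hnt Hr Hdiam Hrho Hlight.
  assert (1 <= INR n) as Hn' by (apply (le_INR 1); auto).
  assert (0 < tau) as Htau by nra.
  assert (s <= INR n) as Hsn by nra.
  pose proof (packing_const_ge n) as HC. set (C := packing_const n) in *.
  assert (1 <= 24 ^ n) as H24 by (apply pow_R1_Rle; lra).
  set (gam := INR n + 1 - s * tau). assert (0 < gam) as Hgam by (unfold gam; lra).
  destruct (nat_ceil (24 / rho)) as [q1 Hq1]; [apply Rle_mult_inv_pos; lra|].
  (* The threshold that [Y ^ gam] must exceed for the growth hypothesis of [light_cell]. *)
  set (Bd := 4 * 8 ^ n * C ^ n * Rpower 2 s / rho ^ n).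
  assert (0 < rho ^ n) as Hrn by (apply pow_lt; lra).
  assert (0 < C ^ n) as HCn by (apply pow_lt; lra).
  assert (0 < 8 ^ n) as H8n by (apply pow_lt; lra).
  assert (0 < Bd) as HBd.
  { unfold Bd. apply Rdiv_lt_0_compat; auto. pose proof (Rpower_gt0 2 s).
    repeat apply Rmult_lt_0_compat; auto; lra. }
  pose proof (Rpower_gt0 Bd (/ gam)) as HBg.
  pose proof (pos_INR N) as HN. pose proof (pos_INR q1) as Hq1p.
  assert (0 <= 384 * INR q1 / rho) as HB1 by (apply Rle_mult_inv_pos; lra).
  assert (0 <= 16 * 24 ^ n / rho) as HB2 by (apply Rle_mult_inv_pos; lra).
  (* One [l] beyond all thresholds: growth, denominators above [N], the condition on [q1] in
     [ubiquity], and a mesh small against [rho]. *)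
  destruct (nat_ceil (Rpower Bd (/ gam) + INR N + 384 * INR q1 / rho + 16 * 24 ^ n / rho + 1))
    as [l [Hl _]]; [lra|].
  assert (1 <= l)%nat as Hl1 by (apply INR_le; simpl; lra).
  set (m := (24 * l)%nat).
  assert (INR m = 24 * INR l) as Em by (unfold m; rewrite mult_INR; simpl; ring).
  set (Y := INR m ^ n).
  assert (INR m <= Y) as HmY by (apply pow_ge_base; auto; lra).
  set (D := INR m ^ (n + 1)).
  assert (D = INR m * Y) as HD by (unfold D, Y; rewrite pow_add; simpl; ring).
  assert (INR m <= D) as HmD by nra.
  assert (384 * INR q1 <= rho * INR m) as Hm1.
  { apply Rmult_le_reg_l with (/ rho); [apply Rinv_0_lt_compat; lra|].
    replace (/ rho * (rho * INR m)) with (INR m) by (field; lra).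
    replace (/ rho * (384 * INR q1)) with (384 * INR q1 / rho) by (field; lra). lra. }
  assert (16 * 24 ^ n <= rho * INR m) as Hm2.
  { apply Rmult_le_reg_l with (/ rho); [apply Rinv_0_lt_compat; lra|].
    replace (/ rho * (rho * INR m)) with (INR m) by (field; lra).
    replace (/ rho * (16 * 24 ^ n)) with (16 * 24 ^ n / rho) by (field; lra). lra. }
  assert (16 * 24 ^ n <= rho * D) as HrD by nra.
  (* Denominators are at most [Y], so [Y ^ (- tau) <= q ^ (- tau)]; the half makes the inequality
     strict. *)
  set (rho' := / 2 * Rpower Y (- tau)).
  assert (0 < rho') as Hrho' by (unfold rho'; pose proof (Rpower_gt0 Y (- tau)); lra).
  assert (rho' * D <= 1) as HrD1.
  { unfold rho'. assert (Rpower Y (- tau) = Rpower (INR m) (- (INR n * tau))) as ->.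
    { unfold Y. rewrite <- Rpower_pow, Rpower_mult by lra. f_equal; ring. }
    unfold D. rewrite <- Rpower_pow by lra. rewrite plus_INR.
    assert (Rpower (INR m) (- (INR n * tau)) * Rpower (INR m) (INR n + INR 1) <= 1); [|lra].
    rewrite <- Rpower_plus. rewrite <- (Rpower_O (INR m)) by lra.
    apply Rle_Rpower; simpl; lra. }
  assert (rho' <= 24 ^ n / D) as HrD2.
  { apply Rmult_le_reg_r with D; [lra|]. replace (24 ^ n / D * D) with (24 ^ n) by (field; lra). lra. }
  assert (2 * 24 ^ n / D <= rho / 8) as HrD3.
  { apply Rmult_le_reg_r with D; [lra|].
    replace (2 * 24 ^ n / D * D) with (2 * 24 ^ n) by (field; lra). lra. }
  assert (0 < 24 ^ n / D) as HrD4 by (apply Rdiv_lt_0_compat; lra).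
  destruct (nat_ceil (rho * D / 8)) as [A HA]; [nra|].
  assert (1 <= A)%nat as HA1 by (apply INR_le; simpl; lra).
  set (b := fun i => IZR (up (y i * D)) / D).
  assert (forall i, y i <= b i <= y i + / D) as Hb.
  { intros i. destruct (archimed (y i * D)). unfold b. split; apply Rmult_le_reg_r with D; try lra.
    - replace (IZR (up (y i * D)) / D * D) with (IZR (up (y i * D))) by (field; lra). lra.
    - replace (IZR (up (y i * D)) / D * D) with (IZR (up (y i * D))) by (field; lra).
      rewrite Rmult_plus_distr_r, Rinv_l by lra. lra. }
  set (G := fun c => exists q, (l ^ n <= q <= m ^ n)%nat /\
     exists p : nat -> Z, forall i, (i < n)%nat ->
       Rabs (b i + INR (digit A i c) / D - IZR (p i) / INR q) <= 24 ^ n / D).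
  assert (INR A ^ n / 2 <= INR (count G (A ^ n))) as HcG.
  { apply ubiquity with (rho := rho) (q1 := q1); auto; unfold D, m in *; try lra. }
  set (Z := fun c (z : nat -> R) => exists q, (l ^ n <= q <= m ^ n)%nat /\
     exists p : nat -> Z, (forall i, z i = IZR (p i) / INR q) /\ forall i, (i < n)%nat ->
       Rabs (b i + INR (digit A i c) / D - IZR (p i) / INR q) <= 24 ^ n / D).
  (* A chosen rational centre for each cell, meaningful on [G] only. *)
  set (z := fun c => epsilon (inhabits (fun _ : nat => 0)) (Z c)).
  assert (forall c, G c -> Z c (z c)) as Hz.
  { intros c (q & Hq & p & Hp). apply epsilon_spec.
    exists (fun i => IZR (p i) / INR q), q; split; auto. exists p; auto. }
  assert (forall c i, G c -> (i < n)%nat ->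
     Rabs (b i + INR (digit A i c) / D - z c i) <= 24 ^ n / D) as Hzb.
  { intros c i Hg Hi. destruct (Hz c Hg) as (q & _ & p & Ez & Hp). rewrite Ez; auto. }
  assert (forall c i, (c < A ^ n)%nat -> G c -> (i < n)%nat -> Rabs (z c i - y i) + rho' <= rho) as Hcont.
  { intros c i _ Hg Hi. specialize (Hzb c i Hg Hi).
    apply Rabs_le_bounds in Hzb. specialize (Hb i).
    pose proof (digit_lt A i c HA1) as Hdl.
    assert (INR (digit A i c) + 1 <= INR A) as Hdl'
      by (rewrite <- S_INR; apply le_INR; lia).
    pose proof (pos_INR (digit A i c)).
    assert (0 <= INR (digit A i c) / D) by (apply Rle_mult_inv_pos; lra).
    assert (INR (digit A i c) / D <= rho / 8).
    { apply Rmult_le_reg_r with D; [lra|].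
      replace (INR (digit A i c) / D * D) with (INR (digit A i c)) by (field; lra). lra. }
    assert (/ D <= 24 ^ n / D).
    { unfold Rdiv. assert (0 < / D) by (apply Rinv_0_lt_compat; lra). nra. }
    assert (Rabs (z c i - y i) <= rho / 8 + 2 * (24 ^ n / D)); [|unfold Rdiv in *; lra].
    apply Rabs_le. lra. }
  destruct (light_cell n A s rho rho' D V r y b G z) as (c & Hc & Hg & Hlc); auto; try lra.
  - intros c i Hg Hi. specialize (Hzb c i Hg Hi). unfold Rdiv in *; lra.
  - fold C.
    assert (Rpower (rho / rho') s <= Rpower 2 s * Rpower Y (tau * s)) as Hp1.
    { rewrite <- Rpower_mult, Rpower_mult_distr by (try lra; apply Rpower_gt0).
      apply Rle_Rpower_l; [lra|]. unfold rho'. rewrite Rpower_Ropp.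
      pose proof (Rpower_gt0 Y tau). split.
      - apply Rdiv_lt_0_compat; [lra|].
        apply Rmult_lt_0_compat; [lra|apply Rinv_0_lt_compat; auto].
      - replace (rho / (/ 2 * / Rpower Y tau)) with (rho * (2 * Rpower Y tau)) by (field; lra). nra. }
    assert (Bd < Rpower Y gam) as Hp2.
    { replace Bd with (Rpower (Rpower Bd (/ gam)) gam).
      - apply Rpower_lt_mono; auto; lra.
      - rewrite Rpower_mult, Rinv_l, Rpower_1; lra. }
    assert ((rho * D / 8) ^ n = rho ^ n / 8 ^ n * (Rpower Y gam * Rpower Y (tau * s))) as ->.
    { rewrite <- Rpower_plus. replace (gam + tau * s) with (INR (n + 1)).
      2:{ unfold gam. rewrite plus_INR. simpl; ring. }
      rewrite Rpower_pow by lra. unfold Rdiv. rewrite !Rpow_mult_distr, pow_inv.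
      unfold Y, D. rewrite <- !pow_mult, (Nat.mul_comm n (n + 1)). ring. }
    pose proof (Rpower_gt0 Y (tau * s)) as HYp.
    apply Rle_lt_trans with (C ^ n * (Rpower 2 s * Rpower Y (tau * s))).
    { apply Rmult_le_compat_l; lra. }
    replace (C ^ n * (Rpower 2 s * Rpower Y (tau * s))) with
      (rho ^ n / 8 ^ n * (Bd * Rpower Y (tau * s)) / 4) by (unfold Bd; field; lra).
    assert (0 < rho ^ n / 8 ^ n) by (apply Rdiv_lt_0_compat; lra).
    assert (rho ^ n / 8 ^ n * (Bd * Rpower Y (tau * s)) <
      rho ^ n / 8 ^ n * (Rpower Y gam * Rpower Y (tau * s))); [|lra].
    apply Rmult_lt_compat_l; auto using Rmult_lt_compat_r.
  - destruct (Hz c Hg) as (q & Hq & p & Ez & Hp).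
    exists q, p, rho'. repeat split; auto; try (unfold Rdiv in *; lra).
    + apply INR_lt. destruct Hq as [Hq _]. apply le_INR in Hq. rewrite pow_INR in Hq.
      pose proof (pow_ge_base (INR l) n ltac:(lra) Hn). lra.
    + destruct Hq as [Hq Hq']. apply le_INR in Hq, Hq'. rewrite pow_INR in Hq, Hq'.
      pose proof (pow_ge_base (INR l) n ltac:(lra) Hn).
      unfold rho'. pose proof (Rpower_gt0 Y (- tau)).
      assert (Rpower Y (- tau) <= Rpower (INR q) (- tau)); [|lra].
      rewrite !Rpower_Ropp. apply Rinv_le_contravar; [apply Rpower_gt0|].
      apply Rle_Rpower_l; unfold Y; lra.
    + intros i Hi. rewrite <- Ez; auto.
    (* The centre is known to agree with [p / q] coordinate by coordinate, so lightness is carried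
       over by comparing which sets touch. *)
    + intros K. eapply Rle_trans; [|apply (Hlc K)]. apply sum_Rle. intros k _.
      destruct (excluded_middle_informative _) as [t|t];
        destruct (excluded_middle_informative _) as [t'|t'];
        try lra; [|left; apply Rpower_gt0].
      exfalso; apply t'. destruct t as (x & Hx & Hw). exists x; split; auto.
      intros i Hi. rewrite Ez; auto.
Qed.

(** * Limits of nested balls and the Jarnik bound *)

Lemma sumsq_coord (n : nat) (x y : nat -> R) (i : nat) :
  (i < n)%nat -> (x i - y i) ^ 2 <= sumsq n x y.
Proof.
  assert (forall k, 0 <= sumsq k x y) as H0.
  { induction k; simpl; [lra|]. pose proof (pow2_ge_0 (x k - y k)). simpl in *; lra. }
  induction n as [|n IH]; intros Hi; [lia|]. cbn [sumsq].
  destruct (Nat.eq_dec i n) as [->|].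
  - pose proof (H0 n). lra.
  - pose proof (IH ltac:(lia)). pose proof (pow2_ge_0 (x n - y n)). lra.
Qed.

Lemma coord_le_dist (n : nat) (x y : Rn n) (i : nat) :
  (i < n)%nat -> Rabs (coord x i - coord y i) <= dist x y.
Proof.
  intros Hi. unfold dist, coord. rewrite <- sqrt_Rsqr_abs, Rsqr_pow2.
  apply sqrt_le_1_alt, sumsq_coord; auto.
Qed.

(** In each coordinate every left endpoint is at most every right endpoint, so the supremum of the
    left ones serves. *)
Lemma nested_boxes_point (y : nat -> nat -> R) (rho : nat -> R) (n : nat) :
  (forall j, 0 <= rho j) ->
  (forall j i, (i < n)%nat -> Rabs (y (S j) i - y j i) + rho (S j) <= rho j) ->
  exists x : Rn n, forall j i, (i < n)%nat -> Rabs (coord x i - y j i) <= rho j.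
Proof.
  intros Hr Hnest.
  assert (forall i, (i < n)%nat -> forall j d,
     y j i - rho j <= y (j + d)%nat i - rho (j + d)%nat /\
     y (j + d)%nat i + rho (j + d)%nat <= y j i + rho j) as Hmono.
  { intros i Hi j; induction d as [|d IH].
    - rewrite Nat.add_0_r; lra.
    - rewrite Nat.add_succ_r. pose proof (Hnest (j + d)%nat i Hi) as K.
      assert (Rabs (y (S (j + d)) i - y (j + d)%nat i) <= rho (j + d)%nat - rho (S (j + d))) as K' by lra.
      apply Rabs_le_bounds in K'. lra. }
  assert (forall i, (i < n)%nat -> forall j j', y j i - rho j <= y j' i + rho j') as Hcross.
  { intros i Hi j j'. destruct (le_lt_dec j j') as [L|L].
    - pose proof (Hmono i Hi j (j' - j)%nat) as K.
      replace (j + (j' - j))%nat with j' in K by lia. pose proof (Hr j'); lra.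
    - pose proof (Hmono i Hi j' (j - j')%nat) as K.
      replace (j' + (j - j'))%nat with j in K by lia. pose proof (Hr j); lra. }
  assert (forall i, exists t, (i < n)%nat -> forall j, y j i - rho j <= t <= y j i + rho j) as Hex.
  { intros i. destruct (le_lt_dec n i) as [L|Hi]; [exists 0; lia|].
    destruct (completeness (fun t => exists j, t = y j i - rho j)) as [t [Hub Hlub]].
    - exists (y O i + rho O). intros t [j ->]. auto.
    - exists (y O i - rho O); exists O; auto.
    - exists t. intros _ j; split.
      + apply Hub; exists j; auto.
      + apply Hlub. intros u [j' ->]. auto. }
  set (t := fun i => if le_lt_dec n i then 0 else epsilon (inhabits 0)
    (fun t => (i < n)%nat -> forall j, y j i - rho j <= t <= y j i + rho j)).
  assert (forall i, (n <= i)%nat -> t i = 0) as Ht.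
  { intros i Hi. unfold t. destruct (le_lt_dec n i); auto; lia. }
  exists (exist _ t Ht). intros j i Hi. unfold coord; simpl. unfold t.
  destruct (le_lt_dec n i); [lia|].
  pose proof (epsilon_spec (inhabits 0) _ (Hex i) Hi j). apply Rabs_le. cbn beta in *. lra.
Qed.

Lemma half_pow_small (x : R) : 0 < x -> exists j, (/ 2) ^ j < x.
Proof.
  intros Hx. destruct (pow_lt_1_zero (/ 2) ltac:(rewrite Rabs_pos_eq; lra) x Hx) as [j Hj].
  exists j. specialize (Hj j (le_n j)). rewrite Rabs_pos_eq in Hj; auto.
  apply pow_le; lra.
Qed.

Lemma geometric_sum (e : R) (N : nat) : 0 <= e -> sum_f_R0 (fun k => e * (/ 2) ^ S k) N <= e.
Proof.
  intros He. assert (sum_f_R0 (fun k => e * (/ 2) ^ S k) N = e - e * (/ 2) ^ S N) as ->.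
  { induction N as [|N IH]; [simpl; field|]. rewrite tech5, IH. simpl; field. }
  assert (0 < (/ 2) ^ S N) by (apply pow_lt; lra). nra.
Qed.

(** Each radius is raised to at least [t k], where [t k ^ s = eps / 2 ^ (k + 2)], at a total cost of
    at most [eps / 2]. Positive radii make [hpow] and [Rpower] agree and cannot be undercut by balls
    shrinking to a point. *)
Lemma Hnull_pos_radii (n : nat) (s eps : R) (E : Rn n -> Prop) :
  0 < s -> 0 < eps -> Hnull n s E ->
  exists (U : nat -> Rn n -> Prop) (r : nat -> R),
    (forall k, 0 < r k) /\ (forall k x y, U k x -> U k y -> dist x y <= r k) /\
    (forall x, E x -> exists k, U k x) /\
    (forall N, sum_f_R0 (fun k => Rpower (r k) s) N <= eps).
Proof.
  intros Hs He HE.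
  destruct (HE 1 (eps / 2) ltac:(lra) ltac:(lra)) as (U & r & Hr & HU & Hsum).
  set (t := fun k => Rpower (eps / 2 * (/ 2) ^ S k) (/ s)).
  assert (forall k, 0 < t k) as Ht by (intros; apply Rpower_gt0).
  exists U, (fun k => Rmax (r k) (t k)). repeat split; auto.
  - intros k. pose proof (Rmax_r (r k) (t k)). pose proof (Ht k). lra.
  - intros k x y Hx Hy. destruct (Hr k) as [_ H]. pose proof (H x y Hx Hy).
    pose proof (Rmax_l (r k) (t k)). lra.
  - intros N.
    apply Rle_trans with (sum_f_R0 (fun k => hpow (r k) s + eps / 2 * (/ 2) ^ S k) N).
    + apply sum_Rle. intros k _.
      assert (0 < eps / 2 * (/ 2) ^ S k) by (apply Rmult_lt_0_compat; [lra|apply pow_lt; lra]).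
      assert (Rpower (t k) s = eps / 2 * (/ 2) ^ S k) as Et.
      { unfold t. rewrite Rpower_mult, Rinv_l, Rpower_1; lra. }
      unfold hpow. pose proof (Ht k). unfold Rmax. destruct (Rle_dec (r k) (t k)); destruct (Rle_dec (r k) 0);
        pose proof (Rpower_gt0 (r k) s); lra.
    + rewrite sum_plus. pose proof (Hsum N). pose proof (geometric_sum (eps / 2) N ltac:(lra)). lra.
Qed.

Lemma jarnik_lower (n : nat) (s tau : R) :
  (1 <= n)%nat -> 0 < s -> s * tau < INR n + 1 -> INR n + 1 < INR n * tau ->
  ~ Hnull n s (W tau n Nstar).
Proof.
  intros Hn Hs Hst Hnt HW.
  pose proof (packing_const_ge n) as HC.
  (* The total mass allowed is exactly what makes the unit ball about 0 light. *)
  destruct (Hnull_pos_radii n s (Rpower (1 / (32 * packing_const n)) s) _ Hs (Rpower_gt0 _ _) HW)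
    as (U & r & Hr & Hdiam & Hcov & Hsum).
  set (V := fun k x => exists u : Rn n, U k u /\ x = coord u).
  assert (forall k x x', V k x -> V k x' -> within n x x' (r k)) as HV.
  { intros k x x' (u & Hu & ->) (u' & Hu' & ->) i Hi.
    eapply Rle_trans; [apply coord_le_dist; auto|apply Hdiam; auto]. }
  set (state := {st : (nat -> R) * R | 0 < snd st <= 1 /\ light n s V r (fst st) (snd st)}).
  assert (forall (N : nat) (st : state), exists st' : state,
    (exists (q : nat) (p : nat -> Z), (N < q)%nat /\
       snd (proj1_sig st') < Rpower (INR q) (- tau) /\
       forall i, fst (proj1_sig st') i = IZR (p i) / INR q) /\
    snd (proj1_sig st') <= snd (proj1_sig st) / 2 /\
    forall i, (i < n)%nat -> Rabs (fst (proj1_sig st') i - fst (proj1_sig st) i)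
        + snd (proj1_sig st') <= snd (proj1_sig st)) as Hstep.
  { intros N [[y rho] [Hrho Hl]]; cbn [proj1_sig fst snd] in *.
    destruct (light_descent n s tau rho V r y N) as (q & p & rho' & Hq & Hrho' & Hlt & Hin & Hl'); auto.
    assert (0 < snd (fun i => IZR (p i) / INR q, rho') <= 1 /\
       light n s V r (fst (fun i => IZR (p i) / INR q, rho')) (snd (fun i => IZR (p i) / INR q, rho')))
      as Hst' by (simpl; split; [lra|auto]).
    exists (exist _ (fun i => IZR (p i) / INR q, rho') Hst'). cbn [proj1_sig fst snd].
    repeat split; auto; try lra. exists q, p; auto. }
  assert (light n s V r (fun _ => 0) 1) as H0.
  { intros K. eapply Rle_trans; [|apply (Hsum K)]. apply sum_Rle; intros k _.
    destruct (excluded_middle_informative _); [lra|left; apply Rpower_gt0]. }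
  assert (0 < snd (fun _ : nat => 0, 1) <= 1 /\
     light n s V r (fst (fun _ : nat => 0, 1)) (snd (fun _ : nat => 0, 1))) as H0'
    by (simpl; split; [lra|auto]).
  set (next := fun N st => proj1_sig (constructive_indefinite_description _ (Hstep N st))).
  (* The stage is passed on as the lower bound for the denominator, so the limit point has
     approximations with arbitrarily large [q]. *)
  set (seqst := fix f (j : nat) : state :=
    match j with O => exist _ (fun _ => 0, 1) H0' | S j' => next j' (f j') end).
  set (y := fun j => fst (proj1_sig (seqst j))).
  set (rho := fun j => snd (proj1_sig (seqst j))).
  assert (forall j, (exists (q : nat) (p : nat -> Z), (j < q)%nat /\
       rho (S j) < Rpower (INR q) (- tau) /\ forall i, y (S j) i = IZR (p i) / INR q) /\
       rho (S j) <= rho j / 2 /\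
       forall i, (i < n)%nat -> Rabs (y (S j) i - y j i) + rho (S j) <= rho j) as Hseq.
  { intros j. unfold y, rho. cbn [seqst]. unfold next.
    apply (proj2_sig (constructive_indefinite_description _ (Hstep j (seqst j)))). }
  assert (forall j, 0 < rho j <= 1 /\ light n s V r (y j) (rho j)) as Hst'.
  { intros j. apply (proj2_sig (seqst j)). }
  assert (forall j, rho j <= (/ 2) ^ j) as Hhalf.
  { induction j as [|j IH]; [apply Hst'|]. simpl. destruct (Hseq j) as (_ & ? & _). lra. }
  destruct (nested_boxes_point y rho n) as [x Hx].
  { intros j; left; apply Hst'. }
  { intros j; apply Hseq. }
  (* The limit point is in [W], so some cover set contains it. That set touches every ball of the
     sequence, so lightness puts its radius below every [rho j], although [r k] is positive. *)
  destruct (Hcov x) as [k Hk].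
  { intros N. destruct (Hseq N) as [(q & p & Hq & Hlt & Hp) _].
    exists q; split; auto. split; [unfold Nstar; lia|]. exists p. intros i Hi.
    rewrite <- Hp. eapply Rle_lt_trans; [apply Hx; auto|auto]. }
  destruct (half_pow_small (r k) (Hr k)) as [j Hj].
  destruct (Hst' j) as [Hrj Hl].
  assert (r k <= rho j / (32 * packing_const n)) as Hle.
  { apply Rpower_le_reg with s; auto.
    - apply Rdiv_lt_0_compat; lra.
    - eapply Rle_trans; [|apply (Hl k)]. unfold touch_mass.
      pose proof (term_le_sum (fun k => if excluded_middle_informative (touches n V (y j) (rho j) k)
                     then Rpower (r k) s else 0) k k) as Hle. cbn beta in Hle.
      destruct (excluded_middle_informative (touches n V (y j) (rho j) k)) as [_|N].
      + apply Hle; auto. intros k'; destruct (excluded_middle_informative _);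
          [left; apply Rpower_gt0|lra].
      + exfalso; apply N. exists (coord x); split; [exists x; auto|]. intros i Hi; auto. }
  assert (rho j / (32 * packing_const n) <= rho j).
  { apply Rmult_le_reg_r with (32 * packing_const n); [lra|].
    replace (rho j / (32 * packing_const n) * (32 * packing_const n)) with (rho j) by (field; lra). nra. }
  pose proof (Hhalf j). lra.
Qed.

(** * Covers and the upper bound *)

Lemma hpow_nonneg (r s : R) : 0 <= hpow r s.
Proof. unfold hpow. destruct (Rle_dec r 0); [lra|left; apply Rpower_gt0]. Qed.

Lemma Hnull_subset (n : nat) (s : R) (E F : Rn n -> Prop) :
  (forall x, E x -> F x) -> Hnull n s F -> Hnull n s E.
Proof.
  intros HEF HF delta eps Hd He.
  destruct (HF delta eps Hd He) as (U & r & Hr & HU & Hs). exists U, r; auto.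
Qed.

(** Covers with radii at most 1 can be taken, and for them raising the exponent lowers each term. *)
Lemma Hnull_exponent_mono (n : nat) (s s' : R) (E : Rn n -> Prop) :
  s <= s' -> Hnull n s E -> Hnull n s' E.
Proof.
  intros Hss HE delta eps Hd He.
  pose proof (Rmin_l delta 1). pose proof (Rmin_r delta 1).
  destruct (HE (Rmin delta 1) eps) as (U & r & Hr & HU & Hs); auto.
  { apply Rmin_glb_lt; lra. }
  exists U, r; repeat split; auto.
  - apply Hr.
  - destruct (Hr k); lra.
  - apply Hr.
  - intros N. eapply Rle_trans; [|apply (Hs N)]. apply sum_Rle; intros k _.
    unfold hpow. destruct (Rle_dec (r k) 0) as [|Hrk]; [lra|].
    destruct (Hr k) as [Hr1 _]. unfold Rpower.
    assert (ln (r k) <= 0) by (rewrite <- ln_1; destruct (Req_dec (r k) 1) as [->|];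
      [lra|left; apply ln_increasing; lra]).
    destruct (Req_dec (s' * ln (r k)) (s * ln (r k))) as [->|Hne]; [lra|].
    left; apply exp_increasing. nra.
Qed.

(** Codes up to [N] come from pairs with both entries at most [N], so the enumerated sum is part of
    a square double sum of nonnegative terms. *)
Lemma sum_cantor_le (f : nat -> nat -> R) (B : R) (N : nat) :
  (forall i j, 0 <= f i j) ->
  (forall I J, sum_f_R0 (fun i => sum_f_R0 (f i) J) I <= B) ->
  sum_f_R0 (fun k => f (fst (of_nat k)) (snd (of_nat k))) N <= B.
Proof.
  intros Hf HB.
  (* Keeps the pairs of code at most [K]; the induction adds one code at a time through [h]. *)
  set (g := fun K i j => if le_dec (to_nat (i, j)) K then f i j else 0).
  assert (forall K i j, 0 <= g K i j) as Hg
    by (intros K i j; unfold g; destruct (le_dec _ K); [auto|lra]).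
  assert (forall k, fst (of_nat k) <= k /\ snd (of_nat k) <= k)%nat as Hb.
  { intros k. pose proof (to_nat_non_decreasing (fst (of_nat k)) (snd (of_nat k))) as K.
    rewrite <- surjective_pairing, cancel_to_of in K. lia. }
  assert (forall h : nat -> nat -> R, (forall i j, 0 <= h i j) -> forall k, (k <= N)%nat ->
    h (fst (of_nat k)) (snd (of_nat k)) <= sum_f_R0 (fun i => sum_f_R0 (h i) N) N) as Hterm.
  { intros h Hh k Hk. destruct (Hb k).
    eapply Rle_trans; [apply (term_le_sum (h (fst (of_nat k))) _ N); auto; lia|].
    apply (term_le_sum (fun i => sum_f_R0 (h i) N)); [|lia].
    intros; apply sum_nonneg; auto. }
  assert (forall K, (K <= N)%nat -> sum_f_R0 (fun k => f (fst (of_nat k)) (snd (of_nat k))) K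
     <= sum_f_R0 (fun i => sum_f_R0 (g K i) N) N) as HK.
  { induction K as [|K IH]; intros HKN.
    - simpl. pose proof (Hterm (g O) (Hg O) O HKN) as T. unfold g in T at 1.
      rewrite <- surjective_pairing, cancel_to_of in T. exact T.
    - rewrite tech5.
      set (h := fun i j => if Nat.eq_dec (to_nat (i, j)) (S K) then f i j else 0).
      assert (forall i j, 0 <= h i j) as Hh
        by (intros i j; unfold h; destruct (Nat.eq_dec _ _); [auto|lra]).
      pose proof (Hterm h Hh (S K) HKN) as T. unfold h in T at 1.
      rewrite <- surjective_pairing, cancel_to_of in T.
      destruct (Nat.eq_dec (S K) (S K)); [|lia].
      specialize (IH ltac:(lia)).
      enough (sum_f_R0 (fun i => sum_f_R0 (g (S K) i) N) N =
        sum_f_R0 (fun i => sum_f_R0 (g K i) N) N + sum_f_R0 (fun i => sum_f_R0 (h i) N) N) by lra.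
      rewrite <- sum_plus. apply sum_eq; intros i _.
      rewrite <- sum_plus. apply sum_eq; intros j _. unfold g, h.
      destruct (le_dec (to_nat (i, j)) (S K)); destruct (le_dec (to_nat (i, j)) K);
        destruct (Nat.eq_dec (to_nat (i, j)) (S K)); lia || lra. }
  eapply Rle_trans; [apply (HK N); auto|]. eapply Rle_trans; [|apply (HB N N)].
  apply sum_Rle; intros i _. apply sum_Rle; intros j _. unfold g.
  destruct (le_dec _ N); [lra|auto].
Qed.

Lemma Hnull_of_double_covers (n : nat) (s : R) (E : Rn n -> Prop) :
  (forall delta eps, 0 < delta -> 0 < eps ->
   exists (U : nat -> nat -> Rn n -> Prop) (r : nat -> nat -> R),
    (forall i j, 0 <= r i j <= delta /\ (forall x y, U i j x -> U i j y -> dist x y <= r i j)) /\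
    (forall x, E x -> exists i j, U i j x) /\
    (forall I J, sum_f_R0 (fun i => sum_f_R0 (fun j => hpow (r i j) s) J) I <= eps)) ->
  Hnull n s E.
Proof.
  intros H delta eps Hd He. destruct (H delta eps Hd He) as (U & r & Hr & HU & Hs).
  exists (fun k => U (fst (of_nat k)) (snd (of_nat k))), (fun k => r (fst (of_nat k)) (snd (of_nat k))).
  split; [auto|]. split.
  - intros x Hx. destruct (HU x Hx) as (i & j & Hij). exists (to_nat (i, j)).
    rewrite cancel_of_to; auto.
  - intros N. apply (sum_cantor_le (fun i j => hpow (r i j) s)); auto.
    intros; apply hpow_nonneg.
Qed.

(** The set of index [i] gets a cover of total at most [eps / 2 ^ (i + 1)]. *)
Lemma Hnull_countable_union (n : nat) (s : R) (E : nat -> Rn n -> Prop) :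
  (forall i, Hnull n s (E i)) -> Hnull n s (fun x => exists i, E i x).
Proof.
  intros H. apply Hnull_of_double_covers. intros delta eps Hd He.
  assert (forall i, exists Ur : (nat -> Rn n -> Prop) * (nat -> R),
    (forall k, 0 <= snd Ur k <= delta /\
               (forall x y, fst Ur k x -> fst Ur k y -> dist x y <= snd Ur k)) /\
    (forall x, E i x -> exists k, fst Ur k x) /\
    (forall N, sum_f_R0 (fun k => hpow (snd Ur k) s) N <= eps * (/ 2) ^ S i)) as Hc.
  { intros i. destruct (H i delta (eps * (/ 2) ^ S i)) as (U & r & K); auto.
    - apply Rmult_lt_0_compat; [lra|apply pow_lt; lra].
    - exists (U, r); exact K. }
  set (c := fun i => proj1_sig (constructive_indefinite_description _ (Hc i))).
  assert (forall i, _) as Hc' by exact (fun i => proj2_sig (constructive_indefinite_description _ (Hc i))).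
  exists (fun i => fst (c i)), (fun i => snd (c i)). repeat split.
  - apply (proj1 (Hc' i)).
  - apply (proj1 (Hc' i)).
  - apply (proj1 (Hc' i)).
  - intros x [i Hx]. destruct (proj1 (proj2 (Hc' i)) x Hx) as [k Hk]. exists i, k; exact Hk.
  - intros I J. eapply Rle_trans; [|apply (geometric_sum eps I); lra].
    apply sum_Rle; intros i _. apply (proj2 (proj2 (Hc' i))).
Qed.

Lemma Hnull_union (n : nat) (s : R) (E F : Rn n -> Prop) :
  Hnull n s E -> Hnull n s F -> Hnull n s (fun x => E x \/ F x).
Proof.
  intros HE HF.
  apply Hnull_subset with (fun x => exists i, (fun i : nat => match i with O => E | _ => F end) i x).
  - intros x [Hx|Hx]; [exists O|exists 1%nat]; auto.
  - apply Hnull_countable_union. intros [|i]; auto.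
Qed.

(** * Natural covers of sets of approximable points *)

Lemma dist_le_within (n : nat) (x y : Rn n) (a : R) :
  0 <= a -> within n (coord x) (coord y) a -> dist x y <= INR n * a.
Proof.
  intros Ha H. unfold dist.
  assert (sumsq n (proj1_sig x) (proj1_sig y) <= INR n * a ^ 2) as Hs.
  { assert (forall k, (k <= n)%nat -> sumsq k (proj1_sig x) (proj1_sig y) <= INR k * a ^ 2) as K;
      [|apply K; auto].
    induction k as [|k IH]; intros Hk; [simpl; lra|]. rewrite S_INR. cbn [sumsq].
    specialize (IH ltac:(lia)). specialize (H k ltac:(lia)). unfold coord in H.
    rewrite <- (pow2_abs (_ - _)).
    pose proof (Rabs_pos (proj1_sig x k - proj1_sig y k)). nra. }
  rewrite <- (sqrt_pow2 (INR n * a)) by (apply Rmult_le_pos; auto using pos_INR).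
  apply sqrt_le_1_alt. eapply Rle_trans; [exact Hs|].
  destruct n as [|n]; [simpl; lra|].
  assert (1 <= INR (S n)) by (apply (le_INR 1); lia).
  assert (0 <= a ^ 2) by (apply pow_le; auto).
  replace ((INR (S n) * a) ^ 2) with (INR (S n) * (INR (S n) * a ^ 2)) by ring. nra.
Qed.

Lemma digit_surj (A n : nat) (d : nat -> nat) :
  (forall i, (i < n)%nat -> (d i < A)%nat) ->
  exists c, (c < A ^ n)%nat /\ forall i, (i < n)%nat -> digit A i c = d i.
Proof.
  revert d; induction n as [|n IH]; intros d Hd.
  - exists O; split; [simpl; lia|intros; lia].
  - destruct (IH (fun i => d (S i))) as (c & Hc & Hdc); [intros; apply Hd; lia|].
    pose proof (Hd O ltac:(lia)).
    exists (d O + c * A)%nat; split; [simpl; nia|].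
    intros [|i] Hi; simpl.
    + rewrite Nat.Div0.mod_add. apply Nat.mod_small; auto.
    + rewrite Nat.div_add, Nat.div_small, Nat.add_0_l by lia. apply Hdc; lia.
Qed.

Lemma sum_prefix_const (M J : nat) (a : R) :
  0 <= a -> sum_f_R0 (fun j => if lt_dec j M then a else 0) J <= INR M * a.
Proof.
  intros Ha.
  assert (forall J, sum_f_R0 (fun j => if lt_dec j M then a else 0) J <= INR (Nat.min M (S J)) * a) as K.
  { induction J0 as [|J0 IH].
    - simpl sum_f_R0. destruct (lt_dec 0 M).
      + replace (Nat.min M 1) with 1%nat by lia. simpl; lra.
      + replace (Nat.min M 1) with O by lia. simpl; lra.
    - rewrite tech5. destruct (lt_dec (S J0) M).
      + replace (Nat.min M (S (S J0))) with (S (Nat.min M (S J0))) by lia. rewrite S_INR. lra.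
      + replace (Nat.min M (S (S J0))) with (Nat.min M (S J0)) by lia. lra. }
  eapply Rle_trans; [apply K|]. apply Rmult_le_compat_r; auto. apply le_INR; lia.
Qed.

(** From [N0] on the partial sums are within [eps] of their supremum. The tail is written as a sum
    from 0 with its first terms erased, to match the finite sums over a cover indexed by all [q]. *)
Lemma small_tail (f : nat -> R) (B eps : R) :
  (forall k, 0 <= f k) -> (forall N, sum_f_R0 f N <= B) -> 0 < eps ->
  exists N0, forall N1 I, (N0 <= N1)%nat -> sum_f_R0 (fun q => if lt_dec N1 q then f q else 0) I <= eps.
Proof.
  intros Hf HB He.
  destruct (completeness (fun t => exists N, t = sum_f_R0 f N)) as [L [Hub Hlub]].
  { exists B. intros t [N ->]; auto. }
  { exists (sum_f_R0 f 0), O; auto. }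
  assert (exists N0, L - eps < sum_f_R0 f N0) as [N0 HN0].
  { apply NNPP; intros Hno. assert (L <= L - eps); [|lra].
    apply Hlub. intros t [N ->]. apply Rnot_lt_le; intros Hlt. apply Hno; exists N; auto. }
  exists N0. intros N1 I HN1.
  pose proof (sum_mono f N0 N1 Hf HN1).
  destruct (le_lt_dec I N1) as [HI|HI].
  - rewrite sum_eq_R0; [lra|]. intros q Hq. destruct (lt_dec N1 q); [lia|auto].
  - assert (forall d, sum_f_R0 (fun q => if lt_dec N1 q then f q else 0) (N1 + d) =
      sum_f_R0 f (N1 + d) - sum_f_R0 f N1) as K.
    { induction d as [|d IH].
      - rewrite Nat.add_0_r, sum_eq_R0; [lra|]. intros q Hq. destruct (lt_dec N1 q); [lia|auto].
      - rewrite Nat.add_succ_r, !tech5, IH. destruct (lt_dec N1 (S (N1 + d))); [lra|lia]. }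
    replace I with (N1 + (I - N1))%nat by lia. rewrite K.
    pose proof (Hub _ (ex_intro _ (N1 + (I - N1))%nat eq_refl)). lra.
Qed.

Lemma indic_term_nonneg (Q : nat -> Prop) (nu : R) (q : nat) : 0 <= indic_term Q nu q.
Proof.
  unfold indic_term. destruct (excluded_middle_informative (Q q)); [left; apply Rpower_gt0|lra].
Qed.

Lemma Rn_bounded (n : nat) (x : nat -> R) : exists K, forall i, (i < n)%nat -> Rabs (x i) <= INR K.
Proof.
  induction n as [|n [K HK]]; [exists O; intros; lia|].
  destruct (nat_ceil (Rabs (x n)) (Rabs_pos _)) as [K' HK'].
  exists (Nat.max K K'). intros i Hi.
  destruct (Nat.eq_dec i n) as [->|].
  - pose proof (le_INR _ _ (Nat.le_max_r K K')). lra.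
  - pose proof (le_INR _ _ (Nat.le_max_l K K')). specialize (HK i ltac:(lia)). lra.
Qed.

(** In a bounded cube there are of order [q ^ n] boxes of size [q ^ (- tau)] about fractions of
    denominator [q]. They contribute at most a constant times [q ^ (n - s * tau) <= q ^ (- nu)], and
    the tail of this series over [Q] is small. *)
Lemma approximable_Hnull (Q : nat -> Prop) (n : nat) (s tau nu : R) :
  subset_Nstar Q -> (1 <= n)%nat -> 1 < tau -> 0 <= s -> INR n + nu <= s * tau ->
  series_converges Q nu -> Hnull n s (W tau n Q).
Proof.
  intros HQ Hn Htau Hs Hst [B HB].
  assert (1 <= INR n) as Hn' by (apply (le_INR 1); auto).
  set (E := fun (K : nat) x => W tau n Q x /\ forall i, (i < n)%nat -> Rabs (coord x i) <= INR K).
  apply Hnull_subset with (fun x => exists K, E K x).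
  { intros x Hx. destruct (Rn_bounded n (coord x)) as [K HK]. exists K; split; auto. }
  apply Hnull_countable_union. intros K. apply Hnull_of_double_covers. intros delta eps Hd He.
  pose proof (pos_INR K) as HK.
  set (C := (4 * (INR K + 1)) ^ n * Rpower (2 * INR n) s).
  assert (0 < C) as HC by (apply Rmult_lt_0_compat; [apply pow_lt; lra|apply Rpower_gt0]).
  destruct (small_tail (indic_term Q nu) B (eps / C) (indic_term_nonneg Q nu) HB) as [N0 HN0].
  { apply Rdiv_lt_0_compat; auto. }
  destruct (nat_ceil (2 * INR n / delta)) as [Nd HNd]; [apply Rle_mult_inv_pos; lra|].
  set (N1 := Nat.max N0 Nd).
  (* Numerators run from [- (K + 1) * q] to [(K + 1) * q]; digits are numerators shifted by
     [S K * q]. *)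
  set (A := fun q => (2 * (S K * q) + 1)%nat).
  set (act := fun q c => Q q /\ (N1 < q)%nat /\ (c < A q ^ n)%nat).
  set (r := fun q => INR n * (2 * Rpower (INR q) (- tau))).
  assert (forall q, (N1 < q)%nat -> 1 <= INR q /\ 0 < Rpower (INR q) (- tau) <= / INR q) as Hq.
  { intros q Hq. assert (1 <= INR q) as Hq1 by (apply (le_INR 1); lia). split; auto.
    split; [apply Rpower_gt0|]. rewrite Rpower_Ropp. apply Rinv_le_contravar; [lra|].
    rewrite <- (Rpower_1 (INR q)) at 1 by lra. apply Rle_Rpower; lra. }
  exists (fun q c x => act q c /\ forall i, (i < n)%nat ->
     Rabs (coord x i - (INR (digit (A q) i c) - INR (S K * q)) / INR q) <= Rpower (INR q) (- tau)).
  (* Inactive pairs carry an empty set and radius 0, which [hpow] counts as 0. *)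
  exists (fun q c => if excluded_middle_informative (act q c) then r q else 0).
  repeat split.
  - destruct (excluded_middle_informative (act i j)); [|lra].
    unfold r. pose proof (Rpower_gt0 (INR i) (- tau)). nra.
  - destruct (excluded_middle_informative (act i j)) as [(_ & Hi & _)|]; [|lra].
    destruct (Hq i Hi) as (Hi1 & Hi2 & Hi3). unfold r.
    (* As [tau > 1], the radius is at most [2 * n / i], and [i > Nd] brings this below [delta]. *)
    assert (2 * INR n <= delta * INR i).
    { assert (INR Nd < INR i) by (apply lt_INR; lia).
      apply Rmult_le_reg_l with (/ delta); [apply Rinv_0_lt_compat; auto|].
      replace (/ delta * (delta * INR i)) with (INR i) by (field; lra).
      replace (/ delta * (2 * INR n)) with (2 * INR n / delta) by (field; lra). lra. }
    apply Rle_trans with (INR n * (2 * / INR i)); [nra|].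
    apply Rmult_le_reg_r with (INR i); [lra|].
    replace (INR n * (2 * / INR i) * INR i) with (2 * INR n) by (field; lra). lra.
  - intros x y [Hact Hx] [_ Hy]. destruct (excluded_middle_informative (act i j)); [|tauto].
    pose proof (Rpower_gt0 (INR i) (- tau)).
    apply dist_le_within; [lra|]. intros k Hk. specialize (Hx k Hk). specialize (Hy k Hk).
    apply Rabs_le_bounds in Hx, Hy. apply Rabs_le. lra.
  - intros x [Hx Hbd]. destruct (Hx N1) as (q & HqN & HqQ & p & Hp).
    destruct (Hq q HqN) as (Hq1 & Hq2 & Hq3).
    assert (/ INR q <= 1) as Hq4 by (rewrite <- Rinv_1; apply Rinv_le_contravar; lra).
    assert (INR (S K * q) = (INR K + 1) * INR q) as ESK by (rewrite mult_INR, S_INR; ring).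
    assert (forall i, (i < n)%nat -> (- Z.of_nat (S K * q) <= p i <= Z.of_nat (S K * q))%Z) as Hpb.
    { intros i Hi. specialize (Hp i Hi). specialize (Hbd i Hi).
      apply Rabs_def2 in Hp. apply Rabs_le_bounds in Hbd.
      assert (IZR (p i) = IZR (p i) / INR q * INR q) as Ep by (field; lra).
      assert (- (INR K + 1) <= IZR (p i) / INR q <= INR K + 1) as Hpq by lra.
      split; apply le_IZR; rewrite ?opp_IZR, <- INR_IZR_INZ, ESK, Ep; nra. }
    destruct (digit_surj (A q) n (fun i => Z.to_nat (p i + Z.of_nat (S K * q)))) as (c & Hc & Hdc).
    { intros i Hi. specialize (Hpb i Hi). unfold A. lia. }
    exists q, c. split; [split; auto|]. intros i Hi. specialize (Hpb i Hi).
    rewrite Hdc by auto. rewrite (INR_IZR_INZ (Z.to_nat _)), Z2Nat.id, plus_IZR, <- INR_IZR_INZ by lia.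
    left. replace (IZR (p i) + INR (S K * q) - INR (S K * q)) with (IZR (p i)) by ring. auto.
  - intros I J.
    apply Rle_trans with (C * sum_f_R0 (fun q => if lt_dec N1 q then indic_term Q nu q else 0) I).
    2:{ specialize (HN0 N1 I ltac:(lia)).
        apply Rle_trans with (C * (eps / C)); [apply Rmult_le_compat_l; lra|].
        apply Req_le; field; lra. }
    rewrite scal_sum. apply sum_Rle. intros q _.
    destruct (classic (Q q /\ (N1 < q)%nat)) as [[HqQ HqN]|Hno].
    2:{ rewrite sum_eq_R0.
        - apply Rmult_le_pos; [|lra]. destruct (lt_dec N1 q); [apply indic_term_nonneg|lra].
        - intros c _. destruct (excluded_middle_informative (act q c)) as [(? & ? & _)|]; [tauto|].
          unfold hpow. destruct (Rle_dec 0 0); lra. }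
    destruct (Hq q HqN) as (Hq1 & Hq2 & _).
    assert (0 < r q) as Hrq by (unfold r; nra).
    apply Rle_trans with (sum_f_R0 (fun c => if lt_dec c (A q ^ n) then Rpower (r q) s else 0) J).
    { apply sum_Rle; intros c _. unfold hpow.
      destruct (excluded_middle_informative (act q c)) as [(_ & _ & Hc)|].
      - destruct (lt_dec c (A q ^ n)); [|lia]. destruct (Rle_dec (r q) 0); lra.
      - destruct (Rle_dec 0 0); [|lra]. destruct (lt_dec c (A q ^ n)); [left; apply Rpower_gt0|lra]. }
    eapply Rle_trans; [apply sum_prefix_const; left; apply Rpower_gt0|].
    destruct (lt_dec N1 q); [|lia]. unfold indic_term.
    destruct (excluded_middle_informative (Q q)); [|tauto].
    rewrite pow_INR.
    assert (INR (A q) <= 4 * (INR K + 1) * INR q) as HA.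
    { unfold A. rewrite plus_INR, !mult_INR, (S_INR K).
      replace (INR 2) with 2 by (simpl; ring). rewrite INR_1.
      pose proof (Rmult_le_pos _ _ HK (Rle_trans _ _ _ Rle_0_1 Hq1)). lra. }
    assert (Rpower (r q) s = Rpower (2 * INR n) s * Rpower (INR q) (- (s * tau))) as ->.
    { unfold r. replace (INR n * (2 * Rpower (INR q) (- tau))) with
        (2 * INR n * Rpower (INR q) (- tau)) by ring.
      rewrite <- Rpower_mult_distr, Rpower_mult by (try apply Rpower_gt0; lra).
      do 2 f_equal. ring. }
    apply Rle_trans with ((4 * (INR K + 1) * INR q) ^ n *
      (Rpower (2 * INR n) s * Rpower (INR q) (- (s * tau)))).
    { apply Rmult_le_compat_r.
      - left; apply Rmult_lt_0_compat; apply Rpower_gt0.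
      - apply pow_incr; split; auto using pos_INR. }
    rewrite Rpow_mult_distr, <- (Rpower_pow n (INR q)) by lra.
    replace ((4 * (INR K + 1)) ^ n * Rpower (INR q) (INR n) *
      (Rpower (2 * INR n) s * Rpower (INR q) (- (s * tau)))) with
      (C * (Rpower (INR q) (INR n) * Rpower (INR q) (- (s * tau)))) by (unfold C; ring).
    rewrite <- Rpower_plus, (Rmult_comm _ C). apply Rmult_le_compat_l; [lra|].
    apply Rle_Rpower; lra.
Qed.

(* Telescoping: [ (q / (q - 1)) ^ t - 1 >= t * ln (q / (q - 1)) >= t / q ]. *)
Lemma p_series_converges (nu : R) : 1 < nu -> series_converges Nstar nu.
Proof.
  intros Hnu. set (t := nu - 1). assert (0 < t) as Ht by (unfold t; lra).
  assert (forall N, sum_f_R0 (indic_term Nstar nu) (S N) <= 1 + / t - / t * Rpower (INR (S N)) (- t)) as K.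
  { induction N as [|N IH].
    - simpl sum_f_R0. unfold indic_term, Nstar.
      destruct (excluded_middle_informative (1 <= 0)%nat); [lia|].
      destruct (excluded_middle_informative (1 <= 1)%nat); [|lia].
      unfold Rpower. rewrite INR_1, ln_1, !Rmult_0_r, exp_0. lra.
    - rewrite tech5. unfold indic_term at 2. unfold Nstar at 2.
      destruct (excluded_middle_informative (1 <= S (S N))%nat); [|lia].
      set (q := INR (S (S N))). assert (INR (S N) = q - 1) as EN by (unfold q; rewrite (S_INR (S N)); ring).
      rewrite EN in IH.
      assert (1 <= q - 1) as Hq by (rewrite <- EN; apply (le_INR 1); lia).
      assert (ln q - ln (q - 1) >= / q) as Hln.
      { assert (0 < (q - 1) / q) by (apply Rdiv_lt_0_compat; lra).
        pose proof (exp_ineq1_le (ln ((q - 1) / q))) as X. rewrite exp_ln in X by auto.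
        unfold Rdiv in X at 1. rewrite ln_mult, ln_Rinv in X by (try apply Rinv_0_lt_compat; lra).
        replace ((q - 1) / q) with (1 - / q) in X by (field; lra). lra. }
      assert (Rpower (q - 1) (- t) >= Rpower q (- t) * (1 + t * / q)) as Hstep.
      { unfold Rpower. replace (- t * ln (q - 1)) with (- t * ln q + t * (ln q - ln (q - 1))) by ring.
        rewrite exp_plus. apply Rle_ge, Rmult_le_compat_l; [left; apply exp_pos|].
        eapply Rle_trans; [|apply exp_ineq1_le]. nra. }
      assert (Rpower q (- nu) = Rpower q (- t) * / q) as ->.
      { replace (- nu) with (- t + - (1)) by (unfold t; ring).
        rewrite Rpower_plus, (Rpower_Ropp q 1), Rpower_1; lra. }
      assert (/ t * t = 1) as Ett by (field; lra).
      assert (0 < / t) by (apply Rinv_0_lt_compat; auto).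
      assert (/ t * Rpower (q - 1) (- t) >= / t * Rpower q (- t) + Rpower q (- t) * / q); [|lra].
      apply Rle_ge.
      replace (/ t * Rpower q (- t) + Rpower q (- t) * / q) with
        (/ t * (Rpower q (- t) * (1 + t * / q))) by (field; lra).
      apply Rmult_le_compat_l; lra. }
  assert (0 < / t) by (apply Rinv_0_lt_compat; auto).
  exists (1 + / t). intros N. eapply Rle_trans; [apply (sum_mono _ N (S N)); [|lia]|].
  - intros; apply indic_term_nonneg.
  - eapply Rle_trans; [apply K|]. pose proof (Rpower_gt0 (INR (S N)) (- t)). nra.
Qed.

(** The cover bound applies to the larger set [W tau n Nstar] with [nu = s * tau - n], which exceeds
    1, so the series over all denominators converges. *)
Lemma Wstar_Hnull_above (Q : nat -> Prop) (n : nat) (s tau : R) :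
  (1 <= n)%nat -> 1 < tau -> (INR n + 1) / tau < s -> Hnull n s (Wstar tau n Q).
Proof.
  intros Hn Htau Hs. pose proof (pos_INR n) as Hn0.
  apply Hnull_subset with (W tau n Nstar); [intros x [Hx _]; exact Hx|].
  assert (INR n + 1 < s * tau) as Hs'.
  { apply Rmult_lt_compat_r with (r := tau) in Hs; [|lra]. field_simplify in Hs; lra. }
  apply approximable_Hnull with (nu := s * tau - INR n); auto; try lra.
  - intros q Hq; exact Hq.
  - apply Rlt_le. eapply Rle_lt_trans; [|exact Hs]. apply Rle_mult_inv_pos; lra.
  - apply p_series_converges; lra.
Qed.

(** Completeness applied to the reflected set. This supplies the dimension where only bounds for it
    are established. *)
Lemma glb_exists (S : R -> Prop) (m0 s0 : R) :
  S s0 -> (forall s, S s -> m0 <= s) -> exists m, is_glb S m.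
Proof.
  intros H0 Hm0. destruct (completeness (fun t => S (- t))) as [L [Hub Hlub]].
  - exists (- m0). intros t Ht. specialize (Hm0 _ Ht). lra.
  - exists (- s0). rewrite Ropp_involutive; auto.
  - exists (- L). split.
    + intros s Hs. rewrite <- (Ropp_involutive s) in Hs. specialize (Hub _ Hs). lra.
    + intros m' Hm'. assert (L <= - m'); [|lra]. apply Hlub. intros t Ht.
      specialize (Hm' _ Ht). lra.
Qed.

(** * The embedding of the hyperplane at height 1 / v *)

Definition snoc {n : nat} (x : Rn n) (a : R) : Rn (S n).
Proof.
  exists (fun i => if Nat.eq_dec i n then a else proj1_sig x i).
  intros i Hi. destruct (Nat.eq_dec i n); [lia|]. apply (proj2_sig x); lia.
Defined.

Lemma dist_snoc (n : nat) (x y : Rn n) (a : R) : dist (snoc x a) (snoc y a) = dist x y.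
Proof.
  unfold dist. f_equal. cbn [sumsq snoc proj1_sig].
  destruct (Nat.eq_dec n n); [|lia].
  assert (forall k, (k <= n)%nat ->
    sumsq k (fun i => if Nat.eq_dec i n then a else proj1_sig x i)
            (fun i => if Nat.eq_dec i n then a else proj1_sig y i)
    = sumsq k (proj1_sig x) (proj1_sig y)) as K.
  { induction k as [|k IH]; intros Hk; auto. cbn [sumsq]. rewrite IH by lia.
    destruct (Nat.eq_dec k n); [lia|auto]. }
  rewrite K by auto. ring.
Qed.

(** The embedding is isometric, so covers pull back with the same radii. *)
Lemma Hnull_snoc_preimage (n : nat) (s a : R) (E : Rn (S n) -> Prop) :
  Hnull (S n) s E -> Hnull n s (fun x => E (snoc x a)).
Proof.
  intros HE delta eps Hd He. destruct (HE delta eps Hd He) as (U & r & Hr & HU & Hs).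
  exists (fun k x => U k (snoc x a)), r. repeat split; auto.
  - apply Hr.
  - apply Hr.
  - intros x y Hx Hy. rewrite <- (dist_snoc n x y a). apply Hr; auto.
Qed.

(* Once [q] is large, [p / q] can only be [q ^ - tau]-close to [1 / v] by being equal to it, so
   that [v] divides [q] and [q] is not in [Q]. *)
Lemma snoc_in_Wstar (Q : nat -> Prop) (n v : nat) (tau tau' : R) (x : Rn n) :
  complement_free Q -> subset_Nstar Q -> (1 <= v)%nat -> ~ Q v -> 1 < tau < tau' ->
  W tau' n Nstar x -> Wstar tau (S n) Q (snoc x (/ INR v)).
Proof.
  intros HQ HQ1 Hv HvQ Htau Hx.
  assert (1 <= INR v) as Hv' by (apply (le_INR 1); auto).
  split.
  - intros N.
    (* For [m] beyond this, [m ^ (tau' - tau)] absorbs the factor [v ^ tau] lost by passing to the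
       denominator [v * m], with which the last coordinate [1 / v] is hit exactly. *)
    destruct (nat_ceil (Rpower (INR v) (tau / (tau' - tau)))) as [M HM]; [left; apply Rpower_gt0|].
    destruct (Hx (Nat.max N M)) as (m & Hm & Hm1 & p & Hp).
    assert (1 <= INR m) as Hm' by (apply (le_INR 1); auto).
    exists (v * m)%nat. split; [nia|]. split; [unfold Nstar in *; nia|].
    exists (fun i => if Nat.eq_dec i n then Z.of_nat m else (Z.of_nat v * p i)%Z).
    intros i Hi. unfold coord, snoc; cbn [proj1_sig]. rewrite mult_INR.
    destruct (Nat.eq_dec i n) as [->|Hin].
    + rewrite <- INR_IZR_INZ. replace (/ INR v - INR m / (INR v * INR m)) with 0 by (field; lra).
      rewrite Rabs_R0. apply Rpower_gt0.
    + rewrite mult_IZR, <- INR_IZR_INZ.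
      replace (INR v * IZR (p i) / (INR v * INR m)) with (IZR (p i) / INR m) by (field; lra).
      eapply Rlt_le_trans; [apply Hp; lia|].
      rewrite !Rpower_Ropp. apply Rinv_le_contravar; [apply Rpower_gt0|].
      rewrite <- Rpower_mult_distr by lra.
      replace tau' with ((tau' - tau) + tau) by ring. rewrite (Rpower_plus (tau' - tau)).
      apply Rmult_le_compat_r; [left; apply Rpower_gt0|].
      replace (Rpower (INR v) tau) with (Rpower (Rpower (INR v) (tau / (tau' - tau))) (tau' - tau)).
      * apply Rle_Rpower_l; [lra|]. split; [apply Rpower_gt0|].
        assert (INR M < INR m) by (apply lt_INR; lia). lra.
      * rewrite Rpower_mult. f_equal. field; lra.
  - intros HW.
    (* For [q] beyond this, [v <= q ^ (tau - 1)], against the inequality [1 / (v * q) < q ^ (- tau)]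
       that a nonzero [d] forces. *)
    destruct (nat_ceil (Rpower (INR v) (/ (tau - 1)))) as [M HM]; [left; apply Rpower_gt0|].
    destruct (HW M) as (q & Hq & HqQ & p & Hp).
    pose proof (HQ1 q HqQ) as Hq1.
    assert (1 <= INR q) as Hq1' by (apply (le_INR 1); auto).
    specialize (Hp n ltac:(lia)). unfold coord, snoc in Hp; cbn [proj1_sig] in Hp.
    destruct (Nat.eq_dec n n); [|lia].
    set (d := (Z.of_nat q - p n * Z.of_nat v)%Z).
    assert (d <> 0)%Z as Hd.
    { intros E. apply (proj1 (HQ q Hq1) HqQ). exists v. repeat split; auto.
      exists (Z.to_nat (p n)). unfold d in E. nia. }
    assert (1 <= Rabs (IZR d)) as Hd1.
    { rewrite <- abs_IZR. apply IZR_le. lia. }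
    replace (/ INR v - IZR (p n) / INR q) with (IZR d * / (INR v * INR q)) in Hp.
    2:{ unfold d. rewrite minus_IZR, mult_IZR, <- !INR_IZR_INZ. field; lra. }
    assert (0 < / (INR v * INR q)) as Hi by (apply Rinv_0_lt_compat; nra).
    rewrite Rabs_mult, (Rabs_pos_eq (/ _)) in Hp by lra.
    assert (/ (INR v * INR q) < Rpower (INR q) (- tau)) as Hlt by nra.
    rewrite Rpower_Ropp in Hlt. pose proof (Rpower_gt0 (INR q) tau) as HP.
    assert (Rpower (INR q) tau < INR v * INR q) as Hlt'.
    { apply Rnot_le_lt; intros L. apply Rinv_le_contravar in L; [lra|nra]. }
    replace tau with ((tau - 1) + 1) in Hlt' by ring.
    rewrite Rpower_plus, Rpower_1 in Hlt' by lra.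
    assert (Rpower (INR q) (tau - 1) < INR v) as Hlt'' by nra.
    assert (INR v <= Rpower (INR q) (tau - 1)); [|lra].
    replace (INR v) with (Rpower (Rpower (INR v) (/ (tau - 1))) (tau - 1)).
    + apply Rle_Rpower_l; [lra|]. split; [apply Rpower_gt0|].
      assert (INR M < INR q) by (apply lt_INR; lia). lra.
    + rewrite Rpower_mult, Rinv_l, Rpower_1; lra.
Qed.

(** * The dimension of the exceptional set in both cases *)

Theorem theorem1 (Q : nat -> Prop) (n : nat) (tau : R) :
  subset_Nstar Q ->
  infinite_set Q ->
  complement_free Q ->
  (exists q, (1 <= q)%nat /\ ~ Q q) ->
  (1 <= n)%nat ->
  1 < tau ->
  ((exists e, is_conv_exponent Q e /\ e < 1) ->
     1 + 1 / INR n < tau ->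
     is_Hausdorff_dim n (Wstar tau n Q) ((INR n + 1) / tau)) /\
  (is_conv_exponent Q 1 ->
     (2 <= n)%nat ->
     1 + 1 / (INR n - 1) < tau ->
     exists d, is_Hausdorff_dim n (Wstar tau n Q) d /\
               INR n / tau <= d <= (INR n + 1) / tau).
Proof.
  intros HQ1 _ HQ (v & Hv & HvQ) Hn Htau.
  assert (1 <= INR n) as Hn' by (apply (le_INR 1); auto).
  assert (0 <= (INR n + 1) / tau) as Hd0 by (apply Rle_mult_inv_pos; lra).
  (* The upper bound shared by both cases, in the form that the infimum asks for. *)
  assert (forall m', (forall s, 0 <= s /\ Hnull n s (Wstar tau n Q) -> m' <= s) ->
    m' <= (INR n + 1) / tau) as Hupper.
  { intros m' Hm'. apply Rnot_lt_le; intros Hlt.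
    set (s := (m' + (INR n + 1) / tau) / 2).
    specialize (Hm' s). assert (m' <= s); [|unfold s in *; lra].
    apply Hm'; split; [unfold s; lra|]. apply Wstar_Hnull_above; auto. unfold s; lra. }
  split.
  - intros (e & [_ Hglb] & He) Hnt.
    assert (exists nu, nu < 1 /\ 0 < nu /\ series_converges Q nu) as (nu & Hnu1 & Hnu0 & Hnu).
    { apply NNPP; intros Hno. assert (1 <= e); [|lra]. apply Hglb. intros nu [H0 Hc].
      apply Rnot_lt_le; intros H1. apply Hno; exists nu; auto. }
    split; auto. intros s [Hs HW]. apply Rnot_lt_le; intros Hlt.
    assert ((INR n + nu) / tau < (INR n + 1) / tau) as Hnt'.
    { apply Rmult_lt_compat_r; [apply Rinv_0_lt_compat|]; lra. }
    pose proof (Rmax_l s ((INR n + nu) / tau)) as Hmax1.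
    pose proof (Rmax_r s ((INR n + nu) / tau)) as Hmax2.
    assert (Rmax s ((INR n + nu) / tau) < (INR n + 1) / tau) as Hmax by (apply Rmax_lub_lt; auto).
    (* Below the Jarnik exponent, yet above both [s] and the cover exponent of [W tau n Q]: at [s']
       both parts of [W tau n Nstar] would be null. *)
    set (s' := (Rmax s ((INR n + nu) / tau) + (INR n + 1) / tau) / 2).
    assert (s < s' /\ (INR n + nu) / tau < s' < (INR n + 1) / tau) as (Hs1 & Hs2 & Hs3)
      by (unfold s'; lra).
    apply Rmult_lt_compat_r with (r := tau) in Hs2, Hs3; [|lra|lra].
    unfold Rdiv in Hs2, Hs3. rewrite Rmult_assoc, Rinv_l, Rmult_1_r in Hs2, Hs3 by lra.
    apply (jarnik_lower n s' tau); auto; try lra.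
    + apply Rmult_lt_compat_l with (r := INR n) in Hnt; [|lra]. field_simplify in Hnt; lra.
    + apply Hnull_subset with (fun x => Wstar tau n Q x \/ W tau n Q x).
      * intros x Hx. destruct (classic (W tau n Q x)); [right|left; split]; auto.
      * apply Hnull_union.
        -- apply Hnull_exponent_mono with s; auto; lra.
        -- apply approximable_Hnull with nu; auto; lra.
  (* From here on [S n] is the ambient dimension and [n] that of the hyperplane. *)
  - intros _ Hn2 Hnt. destruct n as [|n]; [lia|].
    assert (forall s, 0 <= s /\ Hnull (S n) s (Wstar tau (S n) Q) -> INR (S n) / tau <= s) as Hlower.
    { intros s [Hs HW]. apply Rnot_lt_le; intros Hlt.
      assert (0 < INR (S n) / tau) as Hp by (apply Rdiv_lt_0_compat; lra).
      set (s' := (s + INR (S n) / tau) / 2).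
      assert (0 < s' /\ s < s' < INR (S n) / tau) as (Hs0 & Hs1 & Hs2) by (unfold s'; lra).
      apply Rmult_lt_compat_r with (r := tau) in Hs2; [|lra].
      unfold Rdiv in Hs2. rewrite Rmult_assoc, Rinv_l, Rmult_1_r in Hs2 by lra.
      (* Between [tau] and [(n + 1) / s'], so that [s' * tau' < n + 1] and the Jarnik bound in
         dimension [n] contradicts nullity. *)
      set (tau' := (tau + INR (S n) / s') / 2).
      assert (tau < INR (S n) / s') as Ht.
      { apply Rmult_lt_reg_r with s'; auto.
        replace (INR (S n) / s' * s') with (INR (S n)) by (field; lra). lra. }
      assert (tau < tau' < INR (S n) / s') as [Ht1 Ht2] by (unfold tau'; lra).
      apply Rmult_lt_compat_r with (r := s') in Ht2; [|lra].
      replace (INR (S n) / s' * s') with (INR (S n)) in Ht2 by (field; lra).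
      rewrite S_INR in *. replace (INR n + 1 - 1) with (INR n) in Hnt by ring.
      assert (1 <= INR n) as Hn1 by (apply (le_INR 1); lia).
      apply Rmult_lt_compat_l with (r := INR n) in Hnt; [|lra].
      replace (INR n * (1 + 1 / INR n)) with (INR n + 1) in Hnt by (field; lra).
      apply (jarnik_lower n s' tau'); auto; try lia; try nra.
      apply Hnull_subset with (fun x => Wstar tau (S n) Q (snoc x (/ INR v))).
      - intros x Hx. apply snoc_in_Wstar with tau'; auto.
      - apply Hnull_snoc_preimage, Hnull_exponent_mono with s; auto; lra. }
    destruct (glb_exists (fun s => 0 <= s /\ Hnull (S n) s (Wstar tau (S n) Q))
      (INR (S n) / tau) ((INR (S n) + 1) / tau + 1)) as [d Hd]; auto.
    { split; [lra|]. apply Wstar_Hnull_above; auto; lra. }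
    exists d. split; [exact Hd|]. split.
    + apply (proj2 Hd); auto.
    + apply Hupper. apply (proj1 Hd).
Qed.
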